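(* There exists a $4$-dimensional family of orthogonal pairs of Cartan subalgebras in $sl(6)$ which contains the standard pair; that is, the moduli space of orthogonal pairs in $sl(6)$ contains an irreducible subvariety of dimension $4$ passing through the point corresponding to the standard pair.
   Context: The base field $F$ is algebraically closed of characteristic zero, and $sl(6)=sl(V)$ with $V=F^6$. Two Cartan subalgebras $H_1,H_2$ of $sl(6)$ are orthogonal if $K(h_1,h_2)=0$ for all $h_1\in H_1$, $h_2\in H_2$, where $K$ is the Killing form; such $(H_1,H_2)$ is called an orthogonal pair. A Cartan subalgebra $H$ determines the set of rank 1 projectors in $H\oplus F\cdot \mathrm{Id}\subset gl(6)$, which are pairwise orthogonal (products zero) and sum to the identity. With an ordering of the projectors chosen, orthogonal pairs correspond to pairs of systems of rank 1 projectors $\{p_i\}_{i=1}^6$, $\{q_j\}_{j=1}^6$ in $V$ with $p_ip_{i'}=0$ for $i\neq i'$, $q_jq_{j'}=0$ for $j\neq j'$, and $\mathrm{Tr}\,p_iq_j=\frac16$ for all $i,j$. The moduli space of orthogonal pairs is the affine GIT quotient, by simultaneous conjugation by $GL(6)$, of the affine variety of such pairs of systems. The standard pair consists of the diagonal Cartan subalgebra $H_0$ in a fixed basis $e_1,\dots,e_6$ and the Cartan subalgebra $H_1$ linearly spanned by $C,C^2,\dots,C^5$, where $C$ is the cyclic permutation operator $e_i\mapsto e_{i+1 \bmod 6}$. *)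

(* Defs.v *)
From HB Require Import structures.
From mathcomp Require Import all_boot all_algebra all_field.
From mathcomp Require Import boolp classical_sets functions.
From mathcomp Require Import mpoly.
From mathcomp Require Import ring.

Set Implicit Arguments.
Unset Strict Implicit.
Unset Printing Implicit Defensive.

Import GRing.Theory.
Local Open Scope classical_set_scope.
Local Open Scope ring_scope.

Section LieAlgebra.
Variable F : fieldType.
Implicit Types (x y : 'M[F]_6) (U V H : {vspace 'M[F]_6}).

Definition sl6 : {vspace 'M[F]_6} := lker (linfun (mxtrace : 'M[F]_6 -> F^o)).

Definition lie x y : 'M[F]_6 := x *m y - y *m x.

(* The trace is taken over gl(6): since sl(6) is an ideal of gl(6), on sl(6)
   this is the Killing form of sl(6). *)
Definition killing_form x y : F := \tr (lin_mx (fun z => lie x (lie y z))).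

Definition lie_span U V : {vspace 'M[F]_6} :=
  <<[seq lie u v | u <- vbasis U, v <- vbasis V]>>%VS.

Definition cartan_subalgebra H : Prop :=
  [/\ (H <= sl6)%VS,
      (lie_span H H <= H)%VS,
      exists k, iter k (lie_span H) H = 0%VS &
      forall x, x \in sl6 -> (forall h, h \in H -> lie x h \in H) -> x \in H].

Definition orthogonal_pair H1 H2 : Prop :=
  [/\ cartan_subalgebra H1, cartan_subalgebra H2 &
      forall h1 h2, h1 \in H1 -> h2 \in H2 -> killing_form h1 h2 = 0].

Definition diag_cartan : {vspace 'M[F]_6} :=
  (<<[seq delta_mx i i | i : 'I_6]>> :&: sl6)%VS.

(* Column convention: the operator sends e_j to e_(j + 1 mod 6). *)
Definition cycle_op : 'M[F]_6 := \matrix_(i, j) (i == ordS j)%:R.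

Definition cycle_cartan : {vspace 'M[F]_6} :=
  <<[seq (cycle_op ^+ k)%R | k <- iota 1 5]>>%VS.

End LieAlgebra.

Section Variety.
Variable F : fieldType.

(* The points of the affine variety whose quotient is the moduli space. *)
Record opair := OPair {
  fst_sys : 'I_6 -> 'M[F]_6;
  snd_sys : 'I_6 -> 'M[F]_6;
  fst_proj : forall i, fst_sys i *m fst_sys i = fst_sys i;
  snd_proj : forall j, snd_sys j *m snd_sys j = snd_sys j;
  fst_rank1 : forall i, \rank (fst_sys i) = 1%N;
  snd_rank1 : forall j, \rank (snd_sys j) = 1%N;
  fst_orth : forall i i', i != i' -> fst_sys i *m fst_sys i' = 0;
  snd_orth : forall j j', j != j' -> snd_sys j *m snd_sys j' = 0;
  opair_trace : forall i j, \tr (fst_sys i *m snd_sys j) = 6%:R^-1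
}.

(* [x] is the pair (H1, H2), with an ordering of the rank 1 projectors chosen
   in each of H1 + F Id and H2 + F Id. *)
Definition represents (x : opair) (H1 H2 : {vspace 'M[F]_6}) : Prop :=
  (forall i, fst_sys x i \in (H1 + <[1%:M]>)%VS) /\
  (forall j, snd_sys x j \in (H2 + <[1%:M]>)%VS).

Definition opair_conj (g : 'M[F]_6) (x y : opair) : Prop :=
  (forall i, fst_sys y i = g *m fst_sys x i *m invmx g) /\
  (forall j, snd_sys y j = g *m snd_sys x j *m invmx g).

(* (b, i, r, c) indexes the entry (r, c) of the i-th projector of the second
   system if b holds, of the first system otherwise. *)
Definition entry_index : finType := (bool * 'I_6 * 'I_6 * 'I_6)%type.

Definition entry (x : opair) (k : entry_index) : F :=
  let: (b, i, r, c) := k in (if b then snd_sys x i else fst_sys x i) r c.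

Definition regular (f : opair -> F) : Prop :=
  exists p : {mpoly F[#|entry_index|]},
    forall x, f x = p.@[fun k => entry x (enum_val k)].

Definition gl_invariant (f : opair -> F) : Prop :=
  forall g x y, g \in unitmx -> opair_conj g x y -> f y = f x.

Definition inv_regular : {pred opair -> F} :=
  fun f => `[< regular f /\ gl_invariant f >].

Lemma inv_regularP f : reflect (regular f /\ gl_invariant f) (f \in inv_regular).
Proof. exact: asboolP. Qed.

Lemma inv_regular_subring : subring_closed inv_regular.
Proof.
split=> [|f g /inv_regularP[[p fp] fi] /inv_regularP[[q gq] gi]
         |f g /inv_regularP[[p fp] fi] /inv_regularP[[q gq] gi]].
- by apply/inv_regularP; split=> //; exists 1 => x; rewrite rmorph1.
- apply/inv_regularP; split.
    by exists (p - q) => x; rewrite mevalB -fp -gq.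
  by move=> h x y uh xy; rewrite !fctE (fi h x y) ?(gi h x y).
- apply/inv_regularP; split.
    by exists (p * q) => x; rewrite mevalM -fp -gq.
  by move=> h x y uh xy; rewrite !fctE (fi h x y) ?(gi h x y).
Qed.

HB.instance Definition _ :=
  GRing.isSubringClosed.Build (opair -> F) inv_regular inv_regular_subring.

(* The ring of GL(6)-invariant regular functions on the variety of pairs. *)
Record invariants := Invariant {
  inv_fun :> opair -> F;
  _ : inv_fun \in inv_regular
}.

HB.instance Definition _ := [isSub for inv_fun].
HB.instance Definition _ := [Choice of invariants by <:].
HB.instance Definition _ :=
  GRing.SubChoice_isSubComPzRing.Build (opair -> F) inv_regular invariants
    (subringClosedP _).

Lemma peval_subproof n (p : {mpoly F[n]}) (f : 'I_n -> invariants) :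
  (fun x => p.@[fun i => f i x]) \in inv_regular.
Proof.
have fP i : regular (f i) /\ gl_invariant (f i).
  by case: (f i) => g /= /inv_regularP.
apply/inv_regularP; split.
  have [q qP] := fin_all_exists (fun i => (fP i).1).
  exists (p \mPo [tuple q i | i < n]) => x.
  by rewrite comp_mpoly_meval; apply: meval_eq => i; rewrite tnth_mktuple qP.
move=> g x y ug xy; apply: meval_eq => i; exact: (fP i).2 ug xy.
Qed.

Definition peval n (p : {mpoly F[n]}) (f : 'I_n -> invariants) : invariants :=
  Invariant (peval_subproof p f).

End Variety.

Section Spectrum.
Variable A : comPzRingType.

Record spec := Spec {
  ideal_of : set A;
  spec0 : ideal_of 0;
  specD : forall a b, ideal_of a -> ideal_of b -> ideal_of (a + b);
  specM : forall a b, ideal_of b -> ideal_of (a * b);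
  spec1 : ~ ideal_of 1;
  spec_prime : forall a b, ideal_of (a * b) -> ideal_of a \/ ideal_of b
}.

Definition zariski_closed (Z : set spec) : Prop :=
  exists S : set A, Z = [set P : spec | S `<=` ideal_of P].

Definition irreducible (Z : set spec) : Prop :=
  Z !=set0 /\
  forall Z1 Z2, zariski_closed Z1 -> zariski_closed Z2 ->
    Z `<=` Z1 `|` Z2 -> Z `<=` Z1 \/ Z `<=` Z2.

Definition ideal_of_set (Z : set spec) : set A :=
  [set a | forall P, Z P -> ideal_of P a].

End Spectrum.

Section Moduli.
Variable F : fieldType.

(* The affine GIT quotient of the variety of pairs by GL(6). *)
Definition moduli := spec (invariants F).

Section Point.
Variable x : opair F.
Let m : set (invariants F) := [set f | f x = 0].

Lemma moduli_point0 : m 0. Proof. by []. Qed.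
Lemma moduli_pointD f g : m f -> m g -> m (f + g).
Proof. by rewrite /m /= fctE => -> ->; rewrite addr0. Qed.
Lemma moduli_pointM f g : m g -> m (f * g).
Proof. by rewrite /m /= fctE => ->; rewrite mulr0. Qed.
Lemma moduli_point1 : ~ m 1.
Proof. by rewrite /m /= => /eqP; rewrite oner_eq0. Qed.
Lemma moduli_point_prime f g : m (f * g) -> m f \/ m g.
Proof. by rewrite /m /= fctE => /eqP; rewrite mulf_eq0 => /orP[]/eqP; tauto. Qed.

(* The image of [x] under the quotient map. *)
Definition moduli_point : moduli :=
  Spec moduli_point0 moduli_pointD moduli_pointM moduli_point1
       moduli_point_prime.
End Point.

Definition alg_indep_mod (J : set (invariants F)) n (f : 'I_n -> invariants F) :
  Prop := forall p : {mpoly F[n]}, J (peval p f) -> p = 0.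

(* For Z closed and irreducible: the transcendence degree over F of the
   coordinate domain of Z, hence of the function field of Z. *)
Definition has_dimension (Z : set moduli) (d : nat) : Prop :=
  (exists f : 'I_d -> invariants F, alg_indep_mod (ideal_of_set Z) f) /\
  (forall f : 'I_d.+1 -> invariants F, ~ alg_indep_mod (ideal_of_set Z) f).

End Moduli.

Lemma mem_sl6 (F : fieldType) (x : 'M[F]_6) : (x \in sl6 F) = (\tr x == 0).
Proof. by rewrite memv_ker lfunE. Qed.

Lemma mul_deltaE (F : fieldType) n (a b : 'M[F]_n) i j :
  (a *m delta_mx i j *m b) i j = a i i * b j j.
Proof.
rewrite mxE (bigD1 j) //= big1 ?addr0 => [|k kj].
  rewrite mxE (bigD1 i) //= big1 ?addr0 => [|k ki]; first by rewrite mxE !eqxx mulr1.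
  by rewrite mxE (negPf ki) mulr0.
rewrite mxE big1 ?mul0r // => l _; rewrite mxE (negPf kj) andbF mulr0 //.
Qed.

Lemma trace_lin_mx (F : fieldType) n (f : 'M[F]_n -> 'M[F]_n) :
  \tr (lin_mx f) = \sum_i \sum_j f (delta_mx i j) i j.
Proof.
rewrite pair_bigA /= /mxtrace (reindex _ (curry_mxvec_bij n n)) /=.
apply: eq_bigr => -[i j] _ /=.
by rewrite !mxE /= vec_mx_delta mxvecE.
Qed.

Lemma killing_formE (F : fieldType) (x y : 'M[F]_6) :
  killing_form x y = 12%:R * \tr (x *m y) - 2%:R * (\tr x * \tr y).
Proof.
have fE z : lie x (lie y z) =
    x *m y *m z *m 1%:M - x *m z *m y - y *m z *m x + 1%:M *m z *m (y *m x).
  by rewrite /lie !(mulmxBl, mulmxBr) !mulmxA !mulmx1 !mul1mx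
    opprB [in LHS]addrA addrAC.
have sumM (a b : 'M[F]_6) :
    \sum_i \sum_j (a *m delta_mx i j *m b) i j = \tr a * \tr b.
  rewrite /mxtrace mulr_suml; apply: eq_bigr => i _; rewrite mulr_sumr.
  by apply: eq_bigr => j _; rewrite mul_deltaE.
rewrite /killing_form trace_lin_mx.
transitivity (\tr (x *m y) * \tr (1%:M : 'M[F]_6) - \tr x * \tr y
   - \tr y * \tr x + \tr (1%:M : 'M[F]_6) * \tr (y *m x)); last first.
  rewrite mxtrace1 (mxtrace_mulC y); ring.
rewrite -!sumM -!sumrB -big_split; apply: eq_bigr => i _.
rewrite -!sumrB -big_split; apply: eq_bigr => j _.
by rewrite fE !mxE.
Qed.

Section Systems.
Variables (F : fieldType) (n : nat) (P : 'I_n -> 'M[F]_n).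
Hypotheses (PP : forall i, P i *m P i = P i) (rP : forall i, \rank (P i) = 1%N).
Hypothesis oP : forall i j, i != j -> P i *m P j = 0.

Lemma rank1_factor m (A : 'M[F]_m) : \rank A = 1%N ->
  exists u : 'cV[F]_m, exists v : 'rV[F]_m, A = u *m v.
Proof.
move=> rA; have : exists u : 'M[F]_(m, \rank A), exists v : 'M[F]_(\rank A, m),
    A = u *m v by exists (col_base A), (row_base A); rewrite mulmx_base.
by rewrite rA.
Qed.

Lemma system_factor : exists U V : 'M[F]_n,
  [/\ V *m U = 1%:M, U *m V = 1%:M & forall i, P i = col i U *m row i V].
Proof.
have [u /fin_all_exists [v Puv]] := fin_all_exists (fun i => rank1_factor (rP i)).
have vu i j : v i *m u j = (i == j)%:R%:M.
  have vui k : v k *m u k = 1%:M.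
    have [c cE] : exists c : F, v k *m u k = c%:M.
      by exists ((v k *m u k) 0 0); rewrite [LHS]mx11_scalar.
    have : c *: P k = P k.
      by rewrite -[RHS]PP Puv mulmxA -[u k *m v k *m u k]mulmxA cE
        mul_mx_scalar scalemxAl.
    move/eqP; rewrite -subr_eq0 -{2}[P k]scale1r -scalerBl scaler_eq0 cE.
    case/orP => [|/eqP P0]; first by rewrite subr_eq0 => /eqP->.
    by have := rP k; rewrite P0 mxrank0.
  have [<-|ij] := eqVneq i j; first exact: vui.
  have := oP ij; rewrite !Puv => /(congr1 (fun A => v i *m A *m u j)).
  rewrite mulmx0 mul0mx !mulmxA vui mul1mx -mulmxA vui mulmx1 => ->.
  by apply/matrixP => r s; rewrite !mxE mul0rn.
pose U := \matrix_(i, j) u j i 0; pose V := \matrix_(i, j) v i 0 j.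
have VU : V *m U = 1%:M.
  apply/matrixP => i j; rewrite mxE [RHS]mxE.
  have := congr1 (fun A : 'M_1 => A 0 0) (vu i j); rewrite !mxE eqxx mulr1n => <-.
  by apply: eq_bigr => k _; rewrite !mxE.
exists U, V; split=> //; first exact: mulmx1C.
move=> i; rewrite Puv; congr (_ *m _); apply/matrixP => r s; rewrite !mxE ord1 //.
Qed.

Lemma system_sum : \sum_i P i = 1%:M.
Proof.
have [U [V [_ UV PE]]] := system_factor.
rewrite -UV; apply/matrixP => r s; rewrite summxE mxE; apply: eq_bigr => k _.
by rewrite PE mxE big_ord_recl big_ord0 addr0 !mxE.
Qed.

Lemma system_sandwich i x : P i *m x *m P i = \tr (x *m P i) *: P i.
Proof.
have [U [V [_ _ PE]]] := system_factor.
have [c cE] : exists c : F, row i V *m x *m col i U = c%:M.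
  by exists ((row i V *m x *m col i U) 0 0); rewrite [LHS]mx11_scalar.
have -> : \tr (x *m P i) = c.
  by rewrite PE mulmxA mxtrace_mulC mulmxA cE mxtrace_scalar mulr1n.
rewrite PE; have -> : col i U *m row i V *m x *m (col i U *m row i V) =
  col i U *m (row i V *m x *m col i U) *m row i V by rewrite !mulmxA.
by rewrite cE mul_mx_scalar scalemxAl.
Qed.

Lemma system_trace i : \tr (P i) = 1.
Proof.
have := system_sandwich i 1%:M; rewrite mulmx1 mul1mx PP -{1}[P i]scale1r.
move/eqP; rewrite -subr_eq0 -scalerBl scaler_eq0 => /orP[|/eqP P0].
  by rewrite subr_eq0 => /eqP.
by have := rP i; rewrite P0 mxrank0.
Qed.

Lemma system_central x : (forall i, x *m P i = P i *m x) ->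
  x = \sum_i \tr (x *m P i) *: P i.
Proof.
move=> xP; rewrite -{1}[x]mulmx1 -system_sum mulmx_sumr; apply: eq_bigr => i _.
by rewrite -system_sandwich -xP -mulmxA PP.
Qed.

Lemma system_span h : h \in <<[seq P i | i : 'I_n]>>%VS ->
  exists a : 'I_n -> F, h = \sum_i a i *: P i.
Proof.
set X := [seq P i | i : 'I_n] => hX.
have sX : size X = n by rewrite size_map size_enum_ord.
exists (fun i => coord (in_tuple X) (cast_ord (esym sX) i) h).
rewrite {1}(coord_span (X := in_tuple X) hX).
rewrite (reindex (cast_ord (esym sX))) /=; last first.
  by exists (cast_ord sX) => i _; rewrite ?cast_ordK ?cast_ordKV.
by apply: eq_bigr => i _; rewrite (nth_map i) ?size_enum_ord //= nth_ord_enum.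
Qed.

Lemma system_mem i : P i \in <<[seq P i | i : 'I_n]>>%VS.
Proof. by apply/memv_span/map_f; rewrite mem_enum. Qed.

Lemma system_sumM (a : 'I_n -> F) i :
  (\sum_j a j *: P j) *m P i = a i *: P i /\ P i *m (\sum_j a j *: P j) = a i *: P i.
Proof.
rewrite mulmx_suml mulmx_sumr; split; rewrite (bigD1 i) //= big1 ?addr0;
  rewrite -?scalemxAl -?scalemxAr ?PP // => j ji;
  rewrite -?scalemxAl -?scalemxAr oP ?scaler0 //.
by rewrite eq_sym.
Qed.
End Systems.

Section Pairs.
Variable F : fieldType.
Hypothesis F6 : (6%:R : F) != 0.

Definition system_cartan (P : 'I_6 -> 'M[F]_6) : {vspace 'M[F]_6} :=
  (<<[seq P i | i : 'I_6]>> :&: sl6 F)%VS.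

Section S.
Variable (P : 'I_6 -> 'M[F]_6).
Hypotheses (PP : forall i, P i *m P i = P i) (rP : forall i, \rank (P i) = 1%N).
Hypothesis oP : forall i j, i != j -> P i *m P j = 0.
Let H := system_cartan P.

Lemma system_cartan_mem i : P i \in (H + <[1%:M]>)%VS.
Proof.
have -> : P i = (P i - 6%:R^-1 *: 1%:M) + 6%:R^-1 *: 1%:M by rewrite subrK.
apply: memv_add; last by rewrite memvZ ?memv_line.
rewrite memv_cap mem_sl6 raddfB /= mxtraceZ mxtrace1 mulVf //.
rewrite (system_trace PP rP oP) subrr eqxx.
rewrite andbT -(system_sum PP rP oP); apply: rpredB; first exact: system_mem.
by apply/rpredZ/rpred_sum => j _; exact: system_mem.
Qed.

Lemma system_cartanP : cartan_subalgebra H.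
Proof.
have HH : lie_span H H = 0%VS.
  apply/eqP; rewrite -subv0; apply/span_subvP => _
    /allpairsP[[u v] /= [/vbasis_mem uH /vbasis_mem vH ->]].
  move: uH vH; rewrite !memv_cap => /andP[/system_span[a ->] _].
  move=> /andP[/system_span[b ->] _].
  rewrite memv0 subr_eq0 mulmx_suml mulmx_sumr; apply/eqP/eq_bigr => i _.
  by have [bl br] := system_sumM PP oP b i; rewrite -scalemxAl -scalemxAr bl br.
split; [exact: capvSr | by rewrite HH sub0v | by exists 1%N; rewrite /= HH |].
move=> x xs xH.
suff xP i : x *m P i = P i *m x.
  rewrite memv_cap xs andbT (system_central PP rP oP xP).
  by apply: rpred_sum => i _; apply/rpredZ/system_mem.
have : lie x (P i) \in H.
  have /memv_addP[h hH [_ /vlineP[c ->] ->]] := system_cartan_mem i.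
  have -> : lie x (h + c *: 1%:M) = lie x h; last exact: xH.
  by rewrite /lie mulmxDl mulmxDr -scalemxAl -scalemxAr mulmx1 mul1mx opprD
    addrACA subrr addr0.
rewrite memv_cap => /andP[/system_span[a aE] _].
apply/eqP; rewrite -subr_eq0; rewrite /lie in aE; rewrite aE; apply/eqP/big1 => j _.
have -> : a j *: P j = P j *m (\sum_k a k *: P k) *m P j.
  by have [_ ->] := system_sumM PP oP a j; rewrite -scalemxAl PP.
rewrite -aE mulmxBr mulmxBl !mulmxA -(mulmxA (P j *m x)).
have [<-|ij] := eqVneq i j; first by rewrite !PP subrr.
by rewrite !oP ?mulmx0 ?mul0mx ?subrr // eq_sym.
Qed.
End S.

Lemma opair_orthogonal (x : opair F) :
  exists H1 H2, orthogonal_pair H1 H2 /\ represents x H1 H2.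
Proof.
case: x => P Q PP QQ rP rQ oP oQ PQ.
exists (system_cartan P), (system_cartan Q); split; last first.
  by split=> i; exact: system_cartan_mem.
split; [exact: system_cartanP | exact: system_cartanP |] => h k.
rewrite !memv_cap !mem_sl6 => /andP[/system_span[a ->] /eqP ta].
move=> /andP[/system_span[b ->] /eqP tb].
rewrite killing_formE ta mul0r mulr0 subr0.
suff -> : \tr ((\sum_i a i *: P i) *m (\sum_i b i *: Q i)) = 6%:R^-1 *
    (\tr (\sum_i a i *: P i) * \tr (\sum_i b i *: Q i)).
  by rewrite ta mul0r !mulr0.
rewrite mulmx_suml !raddf_sum /= mulr_suml mulr_sumr; apply: eq_bigr => i _.
rewrite mulmx_sumr raddf_sum /= !mulr_sumr; apply: eq_bigr => j _.
rewrite -scalemxAl -scalemxAr !mxtraceZ PQ.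
rewrite (system_trace PP rP oP) (system_trace QQ rQ oQ).
by ring.
Qed.
End Pairs.

Lemma pchar0_natf_neq0 (F : fieldType) : [pchar F] =i pred0 ->
  (6%:R : F) != 0.
Proof. by move/pcharf0P => ->. Qed.

Lemma prim_root6_exists (F : closedFieldType) : (6%:R : F) != 0 ->
  exists z : F, 6.-primitive_root z.
Proof.
move=> F6; have [r rE] := closed_field_poly_normal ('X^6 - 1 : {poly F}).
rewrite (monicP (monicXnsubC 1 (isT : (0 < 6)%N))) scale1r in rE.
have ur : uniq r.
  by rewrite -separable_prod_XsubC -rE; exact: cyclotomic.separable_Xn_sub_1.
have sr : size r = 6.
  have := size_XnsubC (1 : F) (isT : (0 < 6)%N).
  by rewrite rE size_prod_XsubC => -[].
have ar : all 6.-unity_root r.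
  by apply/allP => z zr; rewrite /root_of_unity rE root_prod_XsubC.
have /hasP[z _ zP] := cyclic.has_prim_root (isT : (0 < 6)%N) ar ur
  (eq_leq (esym sr)).
by exists z.
Qed.

Lemma cycle_opX (F : fieldType) k r s :
  (cycle_op F ^+ k) r s = (r == (s + k) %% 6 :> nat)%N%:R.
Proof.
elim: k r s => [|k IH] r s; first by rewrite expr0 mxE addn0 modn_small.
rewrite exprSr mxE (bigD1 (ordS s)) //= big1 ?addr0 => [|j js].
  by rewrite IH mxE eqxx mulr1 /= modnDml addSnnS.
by rewrite [X in _ * X]mxE (negPf js) mulr0.
Qed.

Lemma standard_exists (F : closedFieldType) : [pchar F] =i pred0 ->
  exists x : opair F, represents x (diag_cartan F) (cycle_cartan F).
Proof.
move=> /pchar0_natf_neq0 F6; have [z zP] := prim_root6_exists F6.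
have z0 : z != 0 by rewrite (prim_root_eq0 zP).
pose u j : 'cV[F]_6 := \col_(r < 6) z ^+ (j * r).
pose v j : 'rV[F]_6 := \row_(s < 6) (6%:R^-1 * z^-1 ^+ (j * s)).
have vu (i j : 'I_6) : v i *m u j = (i == j)%:R%:M.
  rewrite [LHS]mx11_scalar; congr (_%:M); rewrite mxE.
  pose w := z ^+ j / z ^+ i.
  transitivity (6%:R^-1 * \sum_(r < 6) w ^+ r).
    rewrite mulr_sumr; apply: eq_bigr => r _; rewrite !mxE -mulrA; congr (_ * _).
    by rewrite mulrC !exprM expr_div_n -exprVn exprVn.
  have [ij|ij] := eqVneq i j.
    rewrite (eq_bigr (fun=> 1)) => [|r _]; last first.
      by rewrite /w ij divff ?expf_neq0 ?expr1n.
    by rewrite sumr_const card_ord mulVf.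
  have w1 : w != 1.
    rewrite /w -subr_eq0 -(divff (expf_neq0 i z0)) -mulrBl.
    rewrite mulf_neq0 ?invr_neq0 ?expf_neq0 //.
    by rewrite subr_eq0 (eq_prim_root_expr zP) !modn_small // eq_sym.
  have : (w - 1) * \sum_(r < 6) w ^+ r = 0.
    rewrite -subrX1 /w expr_div_n -!exprM ![(_ * 6)%N]mulnC !exprM.
    by rewrite (prim_expr_order zP) !expr1n divr1 subrr.
  by move/eqP; rewrite mulf_eq0 subr_eq0 (negPf w1) /= => /eqP ->; rewrite mulr0.
pose P (i : 'I_6) : 'M[F]_6 := delta_mx i i.
pose Q (j : 'I_6) : 'M[F]_6 := u j *m v j.
have QQ (i j : 'I_6) : Q i *m Q j = if i == j then Q j else 0.
  rewrite /Q mulmxA -(mulmxA (u i)) vu.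
  case: eqVneq => [->|_]; first by rewrite mulmx1.
  by rewrite mul_mx_scalar scale0r mul0mx.
have trQ (i j : 'I_6) : \tr (P i *m Q j) = 6%:R^-1.
  rewrite /mxtrace (bigD1 i) //= big1 ?addr0 => [|k ki].
    rewrite mxE (bigD1 i) //= big1 ?addr0 => [|k ki]; last first.
      by rewrite mxE (negPf ki) andbF mul0r.
    rewrite mxE !eqxx mul1r mxE big_ord_recl big_ord0 addr0 !mxE.
    rewrite mulrCA -exprMn divff //.
    by rewrite expr1n mulr1.
  by rewrite mxE big1 // => l _; rewrite mxE (negPf ki) mul0r.
have rQ j : \rank (Q j) = 1%N.
  apply/eqP; rewrite eqn_leq lt0n mxrank_eq0; apply/andP; split.
    exact: leq_trans (mxrankM_maxl _ _) (rank_leq_col _).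
  apply/eqP => Q0; have := trQ j j; rewrite Q0 mulmx0 mxtrace0 => /esym/eqP.
  by rewrite invr_eq0 (negPf F6).
have PP i : P i *m P i = P i by rewrite mul_delta_mx.
have Q1 j : Q j *m Q j = Q j by rewrite QQ eqxx.
have rP i : \rank (P i) = 1%N by exact: mxrank_delta.
have oP i j : i != j -> P i *m P j = 0 by exact: mul_delta_mx_0.
have oQ i j : i != j -> Q i *m Q j = 0 by rewrite QQ => /negPf->.
exists (OPair PP Q1 rP rQ oP oQ trQ); split=> j /=.
  exact: (system_cartan_mem F6 PP rP oP).
have -> : Q j = \sum_(k < 6) (6%:R^-1 * z ^+ (j * k)) *: cycle_op F ^+ k.
  apply/matrixP => r s; rewrite mxE big_ord_recl big_ord0 addr0 !mxE summxE.
  pose k : 'I_6 := inZp (r + (6 - s))%N.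
  have kP : ((s + k) %% 6 = r)%N.
    rewrite /k /= modnDmr addnCA subnKC ?modnDr ?modn_small //.
    exact: ltnW.
  rewrite (bigD1 k) //= big1 ?addr0 => [|l lk].
    rewrite mxE cycle_opX kP eqxx mulr1 mulrCA; congr (_ * _).
    rewrite exprVn; apply: (canLR (mulfK _)); first by rewrite expf_neq0.
    rewrite -exprD -mulnDr; apply/eqP.
    by rewrite (eq_prim_root_expr zP) -[X in _ == X]modnMmr addnC kP.
  rewrite mxE cycle_opX; case: eqP => [e|]; last by rewrite mulr0.
  case/negP: lk; apply/eqP/val_inj; move: kP; rewrite [X in _ = X]e => /eqP.
  by rewrite eqn_modDl !modn_small // => /eqP.
rewrite big_ord_recl expr0 addrC; apply: memv_add; last by rewrite memvZ ?memv_line.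
apply: rpred_sum => k _; rewrite memvZ //; apply: memv_span; apply/mapP.
by exists (nat_of_ord (lift ord0 k)) => //; rewrite mem_iota /= ltnS ltn_ord.
Qed.

(* Main.v *)
Require Import Defs.
From HB Require Import structures.
From mathcomp Require Import all_boot all_fingroup all_algebra all_field.
From mathcomp Require Import boolp classical_sets functions.
From mathcomp Require Import mpoly ring.
Set Implicit Arguments.
Unset Strict Implicit.
Unset Printing Implicit Defensive.
Import GRing.Theory.
Local Open Scope classical_set_scope.
Local Open Scope ring_scope.

(* A pair of systems with all traces 1/6 is, up to conjugation and scaling, a type II
   matrix W: the matrix Y of the inverses of its entries, transposed, satisfies
   W Y = 6. The standard pair corresponds to the Fourier matrix.

   Cut W into 3 x 3 blocks E, B, C, D and let primes denote the entrywise inverse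
   transposes. The vector field dE = hat(EE') E - E hat(E'E), taken
   with sign + on E, D and - on B, C, preserves the type II equations: the Gram
   matrices obey dM = +-[hat M, M], where [hat M, M] is unchanged by M |-> 6 - M, and
   the mixed blocks obey a linear homogeneous equation.
   Its formal flows for four choices of rows and columns, composed over iterated
   power series rings, give a type II matrix over a domain R that specializes to the
   Fourier matrix. The family is the closure of this generic point: the ideal of the
   invariants vanishing at it is prime, and it does not depend on the polynomials
   representing the invariants because, by a Nullstellensatz, a
   polynomial not vanishing at W does not vanish at some specialization of W to F.

   The first-order motions at the Fourier matrix have a nonsingular Jacobian on four
   cross ratios, so the dimension is at least 4. Conversely, five algebraically
   independent values would yield five independent derivations of Frac R, hence five
   independent solutions of the linearized type II equations at W, whereas these
   equations already have a solution space of dimension 4 at the Fourier matrix, as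
   one sees on the discrete Fourier transforms of the rows. *)

(** * Formal power series and derivations *)

Section PowerSeries.
Variable R : idomainType.

Record fps := Fps { fcoef : nat -> R }.
Implicit Types f g h : fps.

Lemma fpsP f g : fcoef f =1 fcoef g <-> f = g.
Proof. by split=> [|->//]; case: f g => [a] [b] /= /funext ->. Qed.

HB.instance Definition _ := gen_eqMixin fps.
HB.instance Definition _ := gen_choiceMixin fps.

Definition fps_add f g := Fps (fun k => fcoef f k + fcoef g k).
Definition fps_opp f := Fps (fun k => - fcoef f k).
Definition fps_mul f g :=
  Fps (fun k => \sum_(i < k.+1) fcoef f i * fcoef g (k - i)%N).
Definition fpsC (c : R) := Fps (fun k => if k == 0%N then c else 0).

Lemma fps_addA : associative fps_add.
Proof. by move=> f g h; apply/fpsP => k /=; rewrite addrA. Qed.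
Lemma fps_addC : commutative fps_add.
Proof. by move=> f g; apply/fpsP => k /=; rewrite addrC. Qed.
Lemma fps_add0 : left_id (fpsC 0) fps_add.
Proof. by move=> f; apply/fpsP => k /=; rewrite if_same add0r. Qed.
Lemma fps_addN : left_inverse (fpsC 0) fps_opp fps_add.
Proof. by move=> f; apply/fpsP => k /=; rewrite if_same addNr. Qed.

HB.instance Definition _ :=
  GRing.isZmodule.Build fps fps_addA fps_addC fps_add0 fps_addN.

(* Truncations are polynomials, so the ring axioms are inherited from {poly R}. *)
Definition trunc n f : {poly R} := \poly_(i < n) fcoef f i.

Lemma coef_trunc n f i : (i < n)%N -> (trunc n f)`_i = fcoef f i.
Proof. by move=> h; rewrite coef_poly h. Qed.

Lemma fcoef_mul_trunc n f g k :
  (k < n)%N -> fcoef (fps_mul f g) k = (trunc n f * trunc n g)`_k.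
Proof.
move=> kn; rewrite coefM /=; apply: eq_bigr => i _.
rewrite !coef_trunc //; first exact: leq_ltn_trans (leq_subr _ _) kn.
exact: leq_ltn_trans (leq_ord i) kn.
Qed.

Lemma coefM_low (p p' q q' : {poly R}) n k : (k < n)%N ->
  (forall i, (i < n)%N -> p`_i = p'`_i) -> (forall i, (i < n)%N -> q`_i = q'`_i) ->
  (p * q)`_k = (p' * q')`_k.
Proof.
move=> kn pp qq; rewrite !coefM; apply: eq_bigr => i _.
rewrite pp ?qq //; first exact: leq_ltn_trans (leq_subr _ _) kn.
exact: leq_ltn_trans (leq_ord i) kn.
Qed.

Lemma fps_mulC : commutative fps_mul.
Proof. by move=> f g; apply/fpsP => k; rewrite !(@fcoef_mul_trunc k.+1) // mulrC. Qed.

Lemma fps_mulA : associative fps_mul.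
Proof.
move=> f g h; apply/fpsP => k; rewrite !(@fcoef_mul_trunc k.+1) //.
transitivity ((trunc k.+1 f * (trunc k.+1 g * trunc k.+1 h))`_k).
  apply: (@coefM_low _ _ _ _ k.+1) => // i ik.
  by rewrite coef_trunc // (@fcoef_mul_trunc k.+1).
rewrite mulrA; apply/esym/(@coefM_low _ _ _ _ k.+1) => // i ik.
by rewrite coef_trunc // (@fcoef_mul_trunc k.+1).
Qed.

Lemma fps_mul1 : left_id (fpsC 1) fps_mul.
Proof.
move=> f; apply/fpsP => k /=; rewrite big_ord_recl /= mul1r subn0 big1 ?addr0 //.
by move=> i _; rewrite mul0r.
Qed.

Lemma fps_mulDl : left_distributive fps_mul fps_add.
Proof.
move=> f g h; apply/fpsP => k /=; rewrite -big_split /=.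
by apply: eq_bigr => i _; rewrite mulrDl.
Qed.

Lemma fps_oner_neq0 : fpsC 1 != 0 :> fps.
Proof. by apply/eqP => /fpsP/(_ 0%N)/= /eqP; rewrite oner_eq0. Qed.

HB.instance Definition _ := GRing.Zmodule_isComNzRing.Build fps
  fps_mulA fps_mulC fps_mul1 fps_mulDl fps_oner_neq0.

Lemma fcoefM f g k :
  fcoef (f * g) k = \sum_(i < k.+1) fcoef f i * fcoef g (k - i)%N.
Proof. by []. Qed.
Lemma fcoefD f g k : fcoef (f + g) k = fcoef f k + fcoef g k. Proof. by []. Qed.
Lemma fcoefN f k : fcoef (- f) k = - fcoef f k. Proof. by []. Qed.
Lemma fcoef0 k : fcoef 0 k = 0. Proof. by rewrite /= if_same. Qed.

Definition fps_unit : pred fps := fun f => `[< exists g, g * f = 1 >].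
Definition fps_inv f : fps :=
  if pselect (exists g, g * f = 1) is left e then projT1 (cid e) else f.

Lemma fps_mulVx : {in fps_unit, left_inverse 1 fps_inv *%R}.
Proof.
by move=> f /asboolP e; rewrite /fps_inv; case: pselect => // e'; case: cid.
Qed.
Lemma fps_unitP f g : g * f = 1 -> fps_unit f.
Proof. by move=> e; apply/asboolP; exists g. Qed.
Lemma fps_inv_out : {in [predC fps_unit], fps_inv =1 id}.
Proof.
by move=> f /asboolPn e; rewrite /fps_inv; case: pselect.
Qed.

HB.instance Definition _ := GRing.ComNzRing_hasMulInverse.Build fps
  fps_mulVx fps_unitP fps_inv_out.

Lemma fps_dom : GRing.integral_domain_axiom fps.
Proof.
move=> f g fg0; apply: contrapT => /negP; rewrite negb_or => /andP[f0 g0].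
have lead h : h != 0 -> exists n, fcoef h n != 0 /\ forall i, (i < n)%N -> fcoef h i = 0.
  move=> h0; have ex : exists n, fcoef h n != 0.
    apply: contrapT => no; move/eqP: h0; apply; apply/fpsP => k; rewrite fcoef0.
    by apply: contrapT => hk; apply: no; exists k; apply/eqP.
  case: (ex_minnP ex) => n hn mn; exists n; split=> // i iltn.
  by apply/eqP; apply: contraLR iltn => /mn; rewrite leqNgt.
have [n [fn0 fn]] := lead f f0; have [m [gm0 gm]] := lead g g0.
(* With [n] and [m] the orders of [f] and [g], one term of the convolution survives in degree
   [n + m]. *)
have : fcoef (f * g) (n + m) = fcoef f n * fcoef g m.
  rewrite fcoefM.
  have nlt : (n < (n + m).+1)%N by rewrite ltnS leq_addr.
  rewrite (bigD1 (Ordinal nlt)) //= addKn big1 ?addr0 // => i /= ni.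
  have [lt|gt|eq] := ltngtP i n; first by rewrite fn ?mul0r.
    rewrite gm ?mulr0 // ltn_subLR; last by rewrite -ltnS ltn_ord.
    by rewrite ltn_add2r.
  by case/negP: ni; apply/eqP/val_inj.
rewrite fg0 fcoef0 => /esym/eqP; rewrite mulf_eq0.
by rewrite (negPf fn0) (negPf gm0).
Qed.

HB.instance Definition _ := GRing.ComUnitRing_isIntegral.Build fps fps_dom.

Definition fps0 f := fcoef f 0.

Lemma fpsC_additive : additive fpsC.
Proof. by move=> a b; apply/fpsP => k /=; case: ifP; rewrite ?subr0. Qed.
Lemma fpsC_monoid : monoid_morphism fpsC.
Proof.
split=> // a b; apply/fpsP => k; rewrite fcoefM big_ord_recl /= subn0.
rewrite big1 ?addr0 => [|i _]; last by rewrite mul0r.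
by case: ifP => // _; rewrite mulr0.
Qed.
HB.instance Definition _ := GRing.isZmodMorphism.Build R fps fpsC fpsC_additive.
HB.instance Definition _ := GRing.isMonoidMorphism.Build R fps fpsC fpsC_monoid.

Lemma fps0_additive : additive fps0.
Proof. by []. Qed.
Lemma fps0_monoid : monoid_morphism fps0.
Proof. by split=> // f g; rewrite /fps0 fcoefM big_ord_recl big_ord0 addr0. Qed.
HB.instance Definition _ := GRing.isZmodMorphism.Build fps R fps0 fps0_additive.
HB.instance Definition _ := GRing.isMonoidMorphism.Build fps R fps0 fps0_monoid.

Definition fps_deriv f := Fps (fun k => fcoef f k.+1 *+ k.+1).
End PowerSeries.

(** * Derivations of an integral domain *)

Section Derivations.
Variable R : idomainType.

Definition derivation (D : R -> R) :=
  (forall a b, D (a + b) = D a + D b) /\ (forall a b, D (a * b) = D a * b + a * D b).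

Section Theory.
Variable D : R -> R.
Hypothesis dD : derivation D.
Lemma derD a b : D (a + b) = D a + D b. Proof. exact: dD.1. Qed.
Lemma derM a b : D (a * b) = D a * b + a * D b. Proof. exact: dD.2. Qed.
Lemma der0 : D 0 = 0.
Proof. by have /eqP := derD 0 0; rewrite addr0 -subr_eq0 opprD addrA subrr sub0r oppr_eq0 => /eqP. Qed.
Lemma derN a : D (- a) = - D a.
Proof. by apply/eqP; rewrite -subr_eq0 opprK -derD addNr der0. Qed.
Lemma derB a b : D (a - b) = D a - D b. Proof. by rewrite derD derN. Qed.
Lemma der1 : D 1 = 0.
Proof.
have /eqP := derM 1 1; rewrite !mulr1 mul1r -subr_eq0 opprD addrA subrr sub0r.
by rewrite oppr_eq0 => /eqP.
Qed.
Lemma der_sum (I : Type) (r : seq I) (P : pred I) (f : I -> R) :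
  D (\sum_(i <- r | P i) f i) = \sum_(i <- r | P i) D (f i).
Proof. exact: (big_morph D derD der0). Qed.
Lemma der_mulmx m n p (A : 'M[R]_(m, n)) (B : 'M[R]_(n, p)) :
  map_mx D (A *m B) = map_mx D A *m B + A *m map_mx D B.
Proof.
apply/matrixP => i j; rewrite !mxE der_sum -big_split /=; apply: eq_bigr => k _.
by rewrite derM !mxE.
Qed.
Lemma map_derD m n (A B : 'M[R]_(m, n)) :
  map_mx D (A + B) = map_mx D A + map_mx D B.
Proof. by apply/matrixP => i j; rewrite !mxE derD. Qed.
End Theory.
End Derivations.

Lemma fps_derivP (R : idomainType) : derivation (@fps_deriv R).
Proof.
split=> f g; apply/fpsP => k; first by rewrite !fcoefD /= mulrnDl.
rewrite fcoefD !fcoefM; transitivity (fcoef (f * g) k.+1 *+ k.+1); first by [].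
rewrite fcoefM /=.
have -> : \sum_(i < k.+1) fcoef f i.+1 *+ i.+1 * fcoef g (k - i) =
    \sum_(i < k.+2) (fcoef f i * fcoef g (k.+1 - i)) *+ i.
  rewrite [RHS]big_ord_recl mulr0n add0r; apply: eq_bigr => i _.
  by rewrite mulrnAl subSS.
have -> : \sum_(i < k.+1) fcoef f i * (fcoef g (k - i).+1 *+ (k - i).+1) =
    \sum_(i < k.+2) (fcoef f i * fcoef g (k.+1 - i)) *+ (k.+1 - i).
  rewrite [RHS]big_ord_recr /= subnn mulr0n addr0; apply: eq_bigr => i _.
  by rewrite mulrnAr subSn // -ltnS.
rewrite -big_split -sumrMnl /=; apply: eq_bigr => i _; rewrite -mulrnDr subnKC //.
by rewrite -ltnS.
Qed.

Definition fps_map (R S : idomainType) (u : R -> S) (f : fps R) :=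
  Fps (fun k => u (fcoef f k)).

(** Acting on coefficients, a derivation of [R] extends to power series. In this way earlier motions
    survive when a new parameter is adjoined. *)
Lemma fps_map_der (R : idomainType) (D : R -> R) :
  derivation D -> derivation (fps_map D).
Proof.
move=> dD; split=> f g; apply/fpsP => k; first exact: derD.
rewrite fcoefD !fcoefM; transitivity (D (fcoef (f * g) k)); first by [].
rewrite fcoefM (der_sum dD) -big_split; apply: eq_bigr => i _.
exact: derM.
Qed.

(** * Formal differential equations *)

Section Ode.
Variables (F : fieldType) (R : idomainType) (iota : {rmorphism F -> R}).
Hypothesis charF : [pchar F] =i pred0.

(** Congruence modulo the [n]-th power of the variable. *)
Definition cong (n : nat) (f g : fps R) := forall k, (k < n)%N -> fcoef f k = fcoef g k.

Lemma cong_refl n f : cong n f f. Proof. by []. Qed.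
Lemma congD n f f' g g' : cong n f f' -> cong n g g' -> cong n (f + g) (f' + g').
Proof. by move=> ff gg k kn; rewrite !fcoefD ff ?gg. Qed.
Lemma congN n f f' : cong n f f' -> cong n (- f) (- f').
Proof. by move=> ff k kn; rewrite !fcoefN ff. Qed.
Lemma congB n f f' g g' : cong n f f' -> cong n g g' -> cong n (f - g) (f' - g').
Proof. by move=> ff gg; apply: congD => //; apply: congN. Qed.
Lemma congM n f f' g g' : cong n f f' -> cong n g g' -> cong n (f * g) (f' * g').
Proof.
move=> ff gg k kn; rewrite !fcoefM; apply: eq_bigr => i _.
rewrite ff ?gg //; first exact: leq_ltn_trans (leq_subr _ _) kn.
exact: leq_ltn_trans (leq_ord i) kn.
Qed.

Definition mcong n p q (A B : 'M[fps R]_(p, q)) := forall i j, cong n (A i j) (B i j).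

Lemma mcong_refl n p q (A : 'M_(p, q)) : mcong n A A. Proof. by []. Qed.
Lemma mcongD n p q (A A' B B' : 'M_(p, q)) :
  mcong n A A' -> mcong n B B' -> mcong n (A + B) (A' + B').
Proof. by move=> a b i j; rewrite !mxE; apply: congD. Qed.
Lemma mcongN n p q (A A' : 'M_(p, q)) : mcong n A A' -> mcong n (- A) (- A').
Proof. by move=> a i j; rewrite !mxE; apply: congN. Qed.
Lemma mcongM n p q r (A A' : 'M_(p, q)) (B B' : 'M_(q, r)) :
  mcong n A A' -> mcong n B B' -> mcong n (A *m B) (A' *m B').
Proof.
move=> a b i j; rewrite !mxE; elim/big_ind2: _ => // [x x' y y'|k _].
  exact: congD.
by apply: congM.
Qed.

Section System.
Variables (p q : nat) (Phi : 'M[fps R]_(p, q) -> 'M[fps R]_(p, q)).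
Hypothesis PhiP : forall n A B, mcong n A B -> mcong n (Phi A) (Phi B).
Let D := @fps_deriv R.

Lemma natS_iota k : iota (k.+1%:R^-1) *+ k.+1 = 1.
Proof.
rewrite -rmorphMn -mulr_natl /= divff ?rmorph1 //.
by move/pcharf0P: charF => ->.
Qed.

Lemma mulrnI_iota k (a b : R) : a *+ k.+1 = b *+ k.+1 -> a = b.
Proof.
move=> /(congr1 (fun c => iota (k.+1%:R^-1) * c)).
by rewrite !mulrnAr -!mulrnAl !natS_iota !mul1r.
Qed.

(** As [Phi] respects truncation, its coefficient of degree [k] depends on degrees up to [k] only,
    so the equation determines the coefficient of degree [k + 1], after a division by [k + 1]. *)
Lemma ode_unique A B : map_mx D A = Phi A -> map_mx D B = Phi B ->
  map_mx (@fps0 R) A = map_mx (@fps0 R) B -> A = B.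
Proof.
move=> dA dB AB0.
suff AB n : mcong n A B by apply/matrixP => i j; apply/fpsP => k; exact: (AB k.+1).
elim: n => // n IH i j [|k] kn; first by move/matrixP/(_ i j): AB0; rewrite !mxE.
apply: (@mulrnI_iota k).
transitivity (fcoef (map_mx D A i j) k); first by rewrite mxE.
rewrite dA (PhiP IH) // -dB mxE //.
Qed.

(** The formal integral of [Phi A] with initial value [A0]; the solutions of the equation are its
    fixed points. *)
Definition picard (A0 : 'M[R]_(p, q)) (A : 'M[fps R]_(p, q)) : 'M[fps R]_(p, q) :=
  \matrix_(i, j) Fps (fun k => if k is k'.+1 then
    iota (k'.+1%:R^-1) * fcoef (Phi A i j) k' else A0 i j).

Lemma picard_cong A0 n A B : mcong n A B -> mcong n.+1 (picard A0 A) (picard A0 B).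
Proof. by move=> AB i j [|k] kn; rewrite !mxE //=; rewrite (PhiP AB). Qed.

Lemma ode_exists (A0 : 'M[R]_(p, q)) :
  exists A, map_mx (@fps0 R) A = A0 /\ map_mx D A = Phi A.
Proof.
pose w n := iter n (picard A0) 0.
have w1 n : mcong n (w n) (w n.+1) by elim: n => // n IH; apply: picard_cong.
have wm n m : (n <= m)%N -> mcong n (w n) (w m).
  move=> /subnK <-; elim: (m - n)%N => // k IH i j l ln.
  rewrite IH // addSn w1 //; exact: leq_trans ln (leq_addl _ _).
(* The coefficient of degree [k] is final from the iterate [k + 1] on. *)
pose A : 'M[fps R]_(p, q) := \matrix_(i, j) Fps (fun k => fcoef (w k.+1 i j) k).
have Aw n : mcong n A (w n) by move=> i j k kn; rewrite mxE /= (wm k.+1 n).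
have AE : A = picard A0 A.
  apply/matrixP => i j; apply/fpsP => k.
  rewrite (Aw k.+1) //; apply/esym.
  exact: (@picard_cong A0 k A (w k) (Aw k) i j k (ltnSn k)).
exists A; split; first by apply/matrixP => i j; rewrite AE !mxE.
rewrite {1}AE; apply/matrixP => i j; apply/fpsP => k.
by rewrite !mxE /= -mulrnAl natS_iota mul1r.
Qed.
End System.
End Ode.

(** * The vector field on 3 x 3 blocks *)

Section HatScalar.
Variable A : comNzRingType.
(* The entry (1, 2) of [hat M] below, in terms of the off-diagonal entries of M. *)
Definition hat3 (r12 r13 r31 r23 r32 : A) := r12 * (1 - r13 * r31) * (1 - r23 * r32).
End HatScalar.

(* For [kappa M := \prod_(i < j) (1 - M i j * M j i)] one has kappa (X Y) = kappa (Y X)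
   whenever Y is the entrywise inverse of X^T, and [hat M] is minus the transposed
   gradient of kappa. The identity equates the derivatives of both sides with
   respect to one entry of X. *)
Lemma kappa_gradient_field (F : fieldType) (a1 a2 a3 b1 b2 b3 c1 c2 c3 : F) :
  a1 != 0 -> a2 != 0 -> a3 != 0 -> b1 != 0 -> b2 != 0 -> b3 != 0 ->
  c1 != 0 -> c2 != 0 -> c3 != 0 ->
  let rab := a1 / b1 + (a2 / b2 + a3 / b3) in
  let rba := b1 / a1 + (b2 / a2 + b3 / a3) in
  let rac := a1 / c1 + (a2 / c2 + a3 / c3) in
  let rca := c1 / a1 + (c2 / a2 + c3 / a3) in
  let rbc := b1 / c1 + (b2 / c2 + b3 / c3) in
  let rcb := c1 / b1 + (c2 / b2 + c3 / b3) in
  let g12 := a1^-1 * a2 + (b1^-1 * b2 + c1^-1 * c2) in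
  let g21 := a2^-1 * a1 + (b2^-1 * b1 + c2^-1 * c1) in
  let g13 := a1^-1 * a3 + (b1^-1 * b3 + c1^-1 * c3) in
  let g31 := a3^-1 * a1 + (b3^-1 * b1 + c3^-1 * c1) in
  let g23 := a2^-1 * a3 + (b2^-1 * b3 + c2^-1 * c3) in
  let g32 := a3^-1 * a2 + (b3^-1 * b2 + c3^-1 * c2) in
  hat3 g12 g13 g31 g23 g32 / a2 + hat3 g13 g12 g21 g32 g23 / a3
  - (b1^-1 * hat3 rba rbc rcb rac rca + c1^-1 * hat3 rca rcb rbc rab rba)
  = - a1^-1 ^+ 2 *
    (hat3 rab rac rca rbc rcb * b1 + hat3 rac rab rba rcb rbc * c1
     - (a2 * hat3 g21 g23 g32 g13 g31 + a3 * hat3 g31 g32 g23 g12 g21)).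
Proof.
move=> a1n a2n a3n b1n b2n b3n c1n c2n c3n /=; rewrite /hat3; field.
by rewrite a1n a2n a3n b1n b2n b3n c1n c2n c3n.
Qed.

(** The field identity is pulled back from the fraction field of [A], where the second family of
    variables becomes the inverses of the first. *)
Lemma kappa_gradient (A : idomainType) (a1 a2 a3 b1 b2 b3 c1 c2 c3 : A)
    (x1 x2 x3 y1 y2 y3 z1 z2 z3 : A) :
  a1 * x1 = 1 -> a2 * x2 = 1 -> a3 * x3 = 1 ->
  b1 * y1 = 1 -> b2 * y2 = 1 -> b3 * y3 = 1 ->
  c1 * z1 = 1 -> c2 * z2 = 1 -> c3 * z3 = 1 ->
  let rab := a1 * y1 + (a2 * y2 + a3 * y3) in
  let rba := b1 * x1 + (b2 * x2 + b3 * x3) in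
  let rac := a1 * z1 + (a2 * z2 + a3 * z3) in
  let rca := c1 * x1 + (c2 * x2 + c3 * x3) in
  let rbc := b1 * z1 + (b2 * z2 + b3 * z3) in
  let rcb := c1 * y1 + (c2 * y2 + c3 * y3) in
  let g12 := x1 * a2 + (y1 * b2 + z1 * c2) in
  let g21 := x2 * a1 + (y2 * b1 + z2 * c1) in
  let g13 := x1 * a3 + (y1 * b3 + z1 * c3) in
  let g31 := x3 * a1 + (y3 * b1 + z3 * c1) in
  let g23 := x2 * a3 + (y2 * b3 + z2 * c3) in
  let g32 := x3 * a2 + (y3 * b2 + z3 * c2) in
  hat3 g12 g13 g31 g23 g32 * x2 + hat3 g13 g12 g21 g32 g23 * x3
  - (y1 * hat3 rba rbc rcb rac rca + z1 * hat3 rca rcb rbc rab rba)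
  = - x1 ^+ 2 *
    (hat3 rab rac rca rbc rcb * b1 + hat3 rac rab rba rcb rbc * c1
     - (a2 * hat3 g21 g23 g32 g13 g31 + a3 * hat3 g31 g32 g23 g12 g21)).
Proof.
have inv (a x : A) : a * x = 1 -> tofrac a != 0 /\ tofrac x = (tofrac a)^-1.
  move=> ax; have ax' : tofrac a * tofrac x = 1 by rewrite -rmorphM ax rmorph1.
  have a0 : tofrac a != 0.
    by apply/eqP => a0; move/eqP: ax'; rewrite a0 mul0r eq_sym oner_eq0.
  by split=> //; rewrite -[LHS](mulKf a0) ax' mulr1.
move=> /inv[n1 e1] /inv[n2 e2] /inv[n3 e3] /inv[n4 e4] /inv[n5 e5] /inv[n6 e6].
move=> /inv[n7 e7] /inv[n8 e8] /inv[n9 e9] /=.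
have th r12 r13 r31 r23 r32 : tofrac (hat3 r12 r13 r31 r23 r32 : A) =
    hat3 (tofrac r12) (tofrac r13) (tofrac r31) (tofrac r23) (tofrac r32).
  by rewrite /hat3 !tofracM !tofracB !tofracM tofrac1.
apply/eqP; rewrite -tofrac_eq; apply/eqP.
rewrite !(th, tofracB, tofracD, tofracM, tofracN, tofracXn, tofrac1).
rewrite e1 e2 e3 e4 e5 e6 e7 e8 e9.
by have /= := kappa_gradient_field n1 n2 n3 n4 n5 n6 n7 n8 n9; apply.
Qed.

Section Hat.
Variable A : comNzRingType.
Implicit Types X Y M : 'M[A]_3.

(** The three elements of Z/3 add up to 0, so for distinct [i] and [j] this is the remaining
    index. *)
Definition third (i j : 'I_3) : 'I_3 := - (i + j).

Definition hat M : 'M[A]_3 := \matrix_(i, j) (if i == j then 0 else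
  let m := third i j in hat3 (M i j) (M i m) (M m i) (M j m) (M m j)).

(** Only off-diagonal entries enter [hat], and there [c - M] is [- M]; [hat3] is odd in its first
    argument and even in the others taken together. *)
Lemma hatN6 M c : hat (c%:M - M) = - hat M.
Proof.
apply/matrixP => i j; rewrite !mxE /hat3.
case: eqVneq => [_|ij]; first by rewrite oppr0.
have [im jm] : i != third i j /\ j != third i j.
  by move: i j ij => [[|[|[|//]]] ?] [[|[|[|//]]] ?].
rewrite ?mxE ?(negPf ij) [_ == i]eq_sym [_ == j]eq_sym (negPf im) (negPf jm).
by rewrite !mulr0n !sub0r !mulrNN -!mulNr.
Qed.

Definition dual X Y := forall i k, X i k * Y k i = 1.

Definition blk X Y := hat (X *m Y) *m X - X *m hat (Y *m X).
End Hat.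

Lemma sum3 (A : zmodType) (f : 'I_3 -> A) i :
  \sum_j f j = f i + (f (i + 1) + f (i + 1 + 1)).
Proof.
rewrite (reindex_inj (addrI i)) !big_ord_recl big_ord0 /=.
have e0 : ord0 = 0 :> 'I_3 by apply/val_inj.
have e1 : lift ord0 ord0 = 1 :> 'I_3 by apply/val_inj.
have e2 : lift ord0 (lift ord0 ord0) = 1 + 1 :> 'I_3 by apply/val_inj.
by rewrite e2 e1 e0 !addr0 -(addrA i).
Qed.

(** This is [kappa_gradient] at the entry [(i, k)], the other indices being listed cyclically. It
    means that when [X] moves along [blk X Y], its entrywise inverse moves along [blk Y X]. *)
Lemma blk_dual (A : idomainType) (X Y : 'M[A]_3) i k :
  dual X Y -> blk Y X k i = - (Y k i) ^+ 2 * blk X Y i k.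
Proof.
move=> XY.
have nz (l : 'I_3) : [/\ l == l + 1 = false, l == l + 1 + 1 = false, l + 1 == l = false,
    l + 1 + 1 == l = false & (l + 1 == l + 1 + 1) = false] by move: l => [[|[|[|//]]] ?].
have th (l : 'I_3) : [/\ third l (l + 1) = l + 1 + 1, third l (l + 1 + 1) = l + 1,
    third (l + 1) l = l + 1 + 1 & third (l + 1 + 1) l = l + 1].
  by move: l => [[|[|[|//]]] ?]; split; apply/val_inj.
have [n1 n2 n3 n4 n5] := nz i; have [m1 m2 m3 m4 m5] := nz k.
have [t1 t2 t3 t4] := th i; have [s1 s2 s3 s4] := th k.
have blkE (U V : 'M[A]_3) j l : blk U V j l =
    \sum_m hat (U *m V) j m * U m l - \sum_m U j m * hat (V *m U) m l.
  by rewrite /blk !mxE.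
rewrite !blkE (sum3 (fun m => _ k m * _) k) (sum3 (fun m => _ i m * _) i).
rewrite (sum3 (fun m => _ * _ m i) i) (sum3 (fun m => _ * _ m k) k).
have hatE (M : 'M[A]_3) j l : hat M j l = if j == l then 0 else
    hat3 (M j l) (M j (third j l)) (M (third j l) j) (M l (third j l)) (M (third j l) l).
  by rewrite mxE.
have XYE j l : (X *m Y) j l = X j k * Y k l + (X j (k + 1) * Y (k + 1) l +
    X j (k + 1 + 1) * Y (k + 1 + 1) l) by rewrite mxE (sum3 _ k).
have YXE j l : (Y *m X) j l = Y j i * X i l + (Y j (i + 1) * X (i + 1) l +
    Y j (i + 1 + 1) * X (i + 1 + 1) l) by rewrite mxE (sum3 _ i).
rewrite !hatE !eqxx n1 n2 n3 n4 m1 m2 m3 m4 t1 t2 t3 t4 s1 s2 s3 s4.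
rewrite !XYE !YXE !(mul0r, mulr0, add0r).
exact: kappa_gradient.
Qed.

(** * The flow of a single block *)

Section BlockFlow.
Variables (F : fieldType) (R : idomainType) (iota : {rmorphism F -> R}).
Hypothesis charF : [pchar F] =i pred0.
Let D := @fps_deriv R.
Let dD : derivation D := fps_derivP R.
Local Notation cst := (map_mx (@fps0 R)).

Lemma hat_cong n (M M' : 'M[fps R]_3) : mcong n M M' -> mcong n (hat M) (hat M').
Proof.
move=> h i j; rewrite !mxE; case: ifP => _ //.
by rewrite /hat3; do !(apply: congM || apply: congB); rewrite //; apply: h.
Qed.

Lemma blk_cong n (X X' Y Y' : 'M[fps R]_3) :
  mcong n X X' -> mcong n Y Y' -> mcong n (blk X Y) (blk X' Y').
Proof.
move=> x y; exact: mcongD (mcongM (hat_cong (mcongM x y)) x)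
  (mcongN (mcongM x (hat_cong (mcongM y x)))).
Qed.

Lemma der_const (f g : fps R) : D f = D g -> fps0 f = fps0 g -> f = g.
Proof.
move=> fg fg0; apply/fpsP => -[|k] //; apply: (mulrnI_iota iota charF (k := k)).
by move/fpsP/(_ k): fg.
Qed.

(** The system is solved in logarithmic form, with opposite logarithmic velocities for dual entries:
    their products then stay constant, and [blk_dual] identifies the velocity of [Y]. The factor [c]
    will carry the sign of the block. *)
Lemma block_flow (c : R) (X0 Y0 : 'M[R]_3) : dual X0 Y0 ->
  exists X Y : 'M[fps R]_3, [/\ dual X Y, cst X = X0, cst Y = Y0,
    map_mx D X = fpsC c *: blk X Y & map_mx D Y = fpsC c *: blk Y X].
Proof.
move=> XY0; pose v (X Y : 'M[fps R]_3) i k := fpsC c * (Y k i * blk X Y i k).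
have [Phi PhiL PhiR] : exists2 Phi : 'M[fps R]_(3, 3 + 3) -> 'M[fps R]_(3, 3 + 3),
    forall Z i k, Phi Z i (lshift 3 k) = lsubmx Z i k * v (lsubmx Z) (rsubmx Z) i k &
    forall Z k i, Phi Z k (rshift 3 i) =
      - (rsubmx Z k i * v (lsubmx Z) (rsubmx Z) i k).
  exists (fun Z => row_mx (\matrix_(i, k) (lsubmx Z i k * v (lsubmx Z) (rsubmx Z) i k))
         (\matrix_(k, i) - (rsubmx Z k i * v (lsubmx Z) (rsubmx Z) i k))) => Z i k.
    by rewrite row_mxEl mxE.
  by rewrite row_mxEr mxE.
have PhiP n Z Z' : mcong n Z Z' -> mcong n (Phi Z) (Phi Z').
  move=> h; have hl : mcong n (lsubmx Z) (lsubmx Z') by move=> i j; rewrite !mxE.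
  have hr : mcong n (rsubmx Z) (rsubmx Z') by move=> i j; rewrite !mxE.
  have hv i k : cong n (v (lsubmx Z) (rsubmx Z) i k) (v (lsubmx Z') (rsubmx Z') i k).
    rewrite /v; apply: congM; first exact: cong_refl.
    apply: congM; [exact: (hr k i) | exact: (blk_cong hl hr i k)].
  move=> i j; case: (split_ordP j) => k ->.
    rewrite (PhiL Z i k) (PhiL Z' i k); apply: congM; [exact: hl | exact: hv].
  rewrite (PhiR Z i k) (PhiR Z' i k).
  by apply: congN; apply: congM; [exact: hr | exact: hv].
have [Z [Z0 dZ]] := ode_exists iota charF PhiP (row_mx X0 Y0).
pose X := lsubmx Z; pose Y := rsubmx Z.
have X0E : cst X = X0 by rewrite -[RHS](row_mxKl X0 Y0) -Z0 map_lsubmx.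
have Y0E : cst Y = Y0 by rewrite -[RHS](row_mxKr X0 Y0) -Z0 map_rsubmx.
have dX i k : D (X i k) = X i k * v X Y i k.
  by rewrite -(PhiL Z i k) -dZ !mxE.
have dY k i : D (Y k i) = - (Y k i * v X Y i k).
  by rewrite -(PhiR Z k i) -dZ !mxE.
have XY : dual X Y.
  move=> i k; apply: der_const.
    by rewrite (derM dD) dX dY (der1 dD); ring.
  rewrite rmorphM rmorph1; have := XY0 i k; rewrite -X0E -Y0E !mxE.
  by [].
exists X, Y; split=> //; apply/matrixP => i k.
  by rewrite [LHS]mxE [RHS]mxE dX /v mulrCA [X i k * _]mulrA XY mul1r.
rewrite [LHS]mxE [RHS]mxE dY (blk_dual _ _ XY) /v; ring.
Qed.

Lemma psi_cong n (M M' : 'M[fps R]_3) :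
  mcong n M M' -> mcong n (hat M *m M - M *m hat M) (hat M' *m M' - M' *m hat M').
Proof.
move=> h; exact: mcongD (mcongM (hat_cong h) h) (mcongN (mcongM h (hat_cong h))).
Qed.

Lemma flow_unique (M N : 'M[fps R]_3) :
  map_mx D M = hat M *m M - M *m hat M -> map_mx D N = hat N *m N - N *m hat N ->
  cst M = cst N -> M = N.
Proof. exact: (ode_unique iota charF psi_cong). Qed.

Lemma linear_unique (H K Z : 'M[fps R]_3) : map_mx D Z = H *m Z + Z *m K ->
  cst Z = 0 -> Z = 0.
Proof.
have lcong n (M M' : 'M[fps R]_3) : mcong n M M' -> mcong n (H *m M + M *m K) (H *m M' + M' *m K).
  by move=> h; exact: mcongD (mcongM (@mcong_refl _ n _ _ H) h) (mcongM h (@mcong_refl _ n _ _ K)).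
move=> dZ Z0; apply: (ode_unique iota charF lcong dZ).
  rewrite mulmx0 mul0mx addr0; apply/matrixP => i j; rewrite [LHS]mxE !mxE; exact: der0 dD.
by rewrite Z0; apply/matrixP => i j; rewrite !mxE.
Qed.

Lemma der_fpsC c : D (fpsC c) = 0.
Proof. by apply/fpsP => k; rewrite fcoef0 /= mul0rn. Qed.
End BlockFlow.

(** * Four block flows assembled into a type II matrix *)

Section Assembly.
Variables (R A : idomainType) (C : {rmorphism R -> A}) (eps : {rmorphism A -> R}) (D : A -> A).
Hypothesis dD : derivation D.
Hypothesis flow : forall (s : R) (X0 Y0 : 'M[R]_3), dual X0 Y0 ->
  exists X Y : 'M[A]_3, [/\ dual X Y, map_mx eps X = X0, map_mx eps Y = Y0,
    map_mx D X = C s *: blk X Y & map_mx D Y = C s *: blk Y X].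

Definition Psi (M : 'M[A]_3) := hat M *m M - M *m hat M.

Hypothesis uniq_Psi : forall M N : 'M[A]_3, map_mx D M = Psi M -> map_mx D N = Psi N ->
  map_mx eps M = map_mx eps N -> M = N.
Hypothesis uniq_lin : forall H K Z : 'M[A]_3, map_mx D Z = H *m Z + Z *m K ->
  map_mx eps Z = 0 -> Z = 0.
Variable c : A.
Hypothesis dc : D c = 0.

(** Both entries of the commutator change sign, up to a scalar matrix, which commutes with
    everything. *)
Lemma Psi_sub M : Psi (c%:M - M) = Psi M.
Proof.
rewrite /Psi hatN6; move: (hat M) => H; rewrite mulNmx mulmxN opprK mulmxBr mulmxBl.
by rewrite mul_mx_scalar mul_scalar_mx opprB addrA subrK.
Qed.

Lemma der_gram (X Y : 'M[A]_3) :
  map_mx D X = blk X Y -> map_mx D Y = blk Y X ->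
  map_mx D (X *m Y) = Psi (X *m Y).
Proof.
move=> dX dY; rewrite (der_mulmx dD) dX dY /blk /Psi.
move: (hat (X *m Y)) (hat (Y *m X)) => H G.
by rewrite mulmxBl mulmxBr !mulmxA addrA subrK.
Qed.

Lemma der_gramN (X Y : 'M[A]_3) :
  map_mx D X = - blk X Y -> map_mx D Y = - blk Y X ->
  map_mx D (X *m Y) = - Psi (X *m Y).
Proof.
move=> dX dY; rewrite (der_mulmx dD) dX dY mulNmx mulmxN -opprD /blk /Psi.
move: (hat (X *m Y)) (hat (Y *m X)) => H G.
by rewrite mulmxBl mulmxBr !mulmxA addrA subrK.
Qed.

(** By [Psi_sub], both [X Y] and [c - U V] solve [dM = Psi M], and they have the same constant
    term. *)
Lemma gram_compl (X Y U V : 'M[A]_3) :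
  map_mx D X = blk X Y -> map_mx D Y = blk Y X ->
  map_mx D U = - blk U V -> map_mx D V = - blk V U ->
  map_mx eps (X *m Y + U *m V) = map_mx eps c%:M ->
  U *m V = c%:M - X *m Y.
Proof.
move=> dX dY dU dV h0.
have dXY := der_gram dX dY; have dUV := der_gramN dU dV.
have dcM : map_mx D (c%:M - U *m V) = - map_mx D (U *m V).
  apply/matrixP => i j; rewrite !mxE (derB dD); case: eqP => _.
    by rewrite mulr1n dc sub0r.
  by rewrite mulr0n (der0 dD) sub0r.
suff -> : X *m Y = c%:M - U *m V by rewrite opprB addrC subrK.
apply: uniq_Psi => //; first by rewrite Psi_sub dcM dUV opprK.
by rewrite map_mxB -h0 map_mxD addrK.
Qed.

(** Complementary Gram matrices have opposite hats, so the inner terms [X hat(X' X) U'] cancel,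
    leaving a linear equation for [X U']. *)
Lemma der_mixed (X X' U U' : 'M[A]_3) :
  map_mx D X = blk X X' -> map_mx D U' = - blk U' U -> U' *m U = c%:M - X' *m X ->
  map_mx D (X *m U') = hat (X *m X') *m (X *m U') + X *m U' *m hat (U *m U').
Proof.
move=> dX dU UU; rewrite (der_mulmx dD) dX dU /blk UU hatN6.
move: (hat (X *m X')) (hat (X' *m X)) (hat (U *m U')) => H G K.
rewrite mulmxBl mulmxN mulmxBr mulNmx mulmxN opprB opprK !mulmxA.
by rewrite [_ + X *m G *m U']addrC addrA subrK.
Qed.

Lemma der_mixedN (X X' U U' : 'M[A]_3) :
  map_mx D X = - blk X X' -> map_mx D U' = blk U' U -> X' *m X = c%:M - U' *m U ->
  map_mx D (X *m U') = - (hat (X *m X') *m (X *m U') + X *m U' *m hat (U *m U')).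
Proof.
move=> dX dU UU; rewrite (der_mulmx dD) dX dU /blk UU hatN6.
move: (hat (X *m X')) (hat (U' *m U)) (hat (U *m U')) => H G K.
rewrite mulNmx mulmxBl mulmxN mulNmx mulmxBr opprK opprD !mulmxA opprD.
by rewrite addrA subrK.
Qed.

Lemma mixed_zero (X X' Y Y' U U' V V' : 'M[A]_3) :
  map_mx D X = blk X X' -> map_mx D U' = - blk U' U ->
  map_mx D Y = - blk Y Y' -> map_mx D V' = blk V' V ->
  U' *m U = c%:M - X' *m X -> Y' *m Y = c%:M - V' *m V ->
  Y *m Y' = c%:M - X *m X' -> V *m V' = c%:M - U *m U' ->
  map_mx eps (X *m U' + Y *m V') = 0 -> X *m U' + Y *m V' = 0.
Proof.
move=> dX dU dY dV UU YY YY2 VV2.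
apply: (@uniq_lin (hat (X *m X')) (hat (U *m U'))).
rewrite (map_derD dD) (der_mixed dX dU UU) (der_mixedN dY dV YY) YY2 VV2 !hatN6.
rewrite mulNmx mulmxN -opprD opprK mulmxDr mulmxDl addrACA //.
Qed.

Lemma sub_complC (M N : 'M[A]_3) : M = c%:M - N -> N = c%:M - M.
Proof. by move=> ->; rewrite opprB addrC subrK. Qed.

Lemma typeII_flow (W0 Y0 : 'M[R]_(3 + 3)) (c0 : R) : c = C c0 -> eps c = c0 ->
  (forall i j, W0 i j * Y0 j i = 1) -> W0 *m Y0 = c0%:M -> Y0 *m W0 = c0%:M ->
  exists W Y : 'M[A]_(3 + 3),
  [/\ map_mx eps W = W0 /\ map_mx eps Y = Y0, forall i j, W i j * Y j i = 1,
      W *m Y = c%:M &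
      [/\ map_mx D (ulsubmx W) = blk (ulsubmx W) (ulsubmx Y),
          map_mx D (ursubmx W) = - blk (ursubmx W) (dlsubmx Y),
          map_mx D (dlsubmx W) = - blk (dlsubmx W) (ursubmx Y) &
          map_mx D (drsubmx W) = blk (drsubmx W) (drsubmx Y)]].
Proof.
move=> cC c0E d0 WY0 YW0.
(* Diagonal blocks flow with sign +, off-diagonal ones with sign -. The partner of an off-diagonal
   block of [W] is the block of [Y] in the transposed position. *)
have [E [E' [dE E0 E0' DE DE']]] : exists X Y : 'M[A]_3, [/\ dual X Y,
    map_mx eps X = ulsubmx W0, map_mx eps Y = ulsubmx Y0, map_mx D X = blk X Y & map_mx D Y = blk Y X].
  have [|X [Y [h1 h2 h3]]] := @flow 1 (ulsubmx W0) (ulsubmx Y0); last first.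
    by rewrite rmorph1 !scale1r; exists X, Y.
  by move=> i k; rewrite !mxE.
have [B [B' [dB B0 B0' DB DB']]] : exists X Y : 'M[A]_3, [/\ dual X Y,
    map_mx eps X = ursubmx W0, map_mx eps Y = dlsubmx Y0, map_mx D X = - blk X Y &
    map_mx D Y = - blk Y X].
  have [|X [Y [h1 h2 h3]]] := @flow (-1) (ursubmx W0) (dlsubmx Y0); last first.
    by rewrite rmorphN1 !scaleN1r; exists X, Y.
  by move=> i k; rewrite !mxE.
have [P [P' [dP P0 P0' DP DP']]] : exists X Y : 'M[A]_3, [/\ dual X Y,
    map_mx eps X = dlsubmx W0, map_mx eps Y = ursubmx Y0, map_mx D X = - blk X Y &
    map_mx D Y = - blk Y X].
  have [|X [Y [h1 h2 h3]]] := @flow (-1) (dlsubmx W0) (ursubmx Y0); last first.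
    by rewrite rmorphN1 !scaleN1r; exists X, Y.
  by move=> i k; rewrite !mxE.
have [Q [Q' [dQ Q0 Q0' DQ DQ']]] : exists X Y : 'M[A]_3, [/\ dual X Y,
    map_mx eps X = drsubmx W0, map_mx eps Y = drsubmx Y0, map_mx D X = blk X Y & map_mx D Y = blk Y X].
  have [|X [Y [h1 h2 h3]]] := @flow 1 (drsubmx W0) (drsubmx Y0); last first.
    by rewrite rmorph1 !scale1r; exists X, Y.
  by move=> i k; rewrite !mxE.
have : block_mx (ulsubmx W0) (ursubmx W0) (dlsubmx W0) (drsubmx W0) *m
    block_mx (ulsubmx Y0) (ursubmx Y0) (dlsubmx Y0) (drsubmx Y0) = block_mx c0%:M 0 0 c0%:M.
  by rewrite !submxK WY0 scalar_mx_block.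
rewrite mulmx_block => /eq_block_mx[a1 a2 a3 a4].
have : block_mx (ulsubmx Y0) (ursubmx Y0) (dlsubmx Y0) (drsubmx Y0) *m
    block_mx (ulsubmx W0) (ursubmx W0) (dlsubmx W0) (drsubmx W0) = block_mx c0%:M 0 0 c0%:M.
  by rewrite !submxK YW0 scalar_mx_block.
rewrite mulmx_block => /eq_block_mx[b1 b2 b3 b4].
have cM : map_mx eps c%:M = c0%:M :> 'M_3 by rewrite map_scalar_mx c0E.
(* The relations [e1], [e3] for rows start from [W0 Y0], the relations [e2], [e4] for columns from
   [Y0 W0]; the mixed products need all four. *)
have e1 := @gram_compl E E' B B' DE DE' DB DB'.
have e2 := @gram_compl E' E P' P DE' DE DP' DP.
have e3 := @gram_compl Q Q' P P' DQ DQ' DP DP'.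
have e4 := @gram_compl Q' Q B' B DQ' DQ DB' DB.
rewrite cM !map_mxD !map_mxM ?E0 ?E0' ?B0 ?B0' ?P0 ?P0' ?Q0 ?Q0' in e1 e2 e3 e4.
have {}e1 := e1 a1; have {}e2 := e2 b1.
have {}e3 := e3 (etrans (addrC _ _) a4); have {}e4 := e4 (etrans (addrC _ _) b4).
have m1 : E *m P' + B *m Q' = 0.
  apply: (@mixed_zero E E' B B' P P' Q Q') => //; first exact: sub_complC.
  by rewrite !map_mxD !map_mxM E0 P0' B0 Q0'.
have m2 : Q *m B' + P *m E' = 0.
  apply: (@mixed_zero Q Q' P P' B B' E E') => //; first exact: sub_complC.
  by rewrite !map_mxD !map_mxM E0' P0 B0' Q0 addrC.
exists (block_mx E B P Q), (block_mx E' P' B' Q'); split.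
- by rewrite !map_block_mx E0 B0 P0 Q0 E0' B0' P0' Q0' !submxK.
- move=> i j; case: (split_ordP i) => {}i ->; case: (split_ordP j) => {}j ->;
  by rewrite ?(block_mxEul, block_mxEur, block_mxEdl, block_mxEdr).
- rewrite mulmx_block m1 [P *m E' + _]addrC m2 scalar_mx_block e1 e3.
  by rewrite addrC subrK subrK.
- by rewrite !block_mxKul !block_mxKur !block_mxKdl !block_mxKdr.
Qed.
End Assembly.

Section Morphisms.
Variables (A B : comNzRingType) (f : {rmorphism A -> B}).
Lemma map_hat (M : 'M[A]_3) : map_mx f (hat M) = hat (map_mx f M).
Proof.
apply/matrixP => i j; rewrite !mxE; case: ifP => _; first exact: rmorph0.
by rewrite /hat3 !mxE !(rmorphM, rmorphB, rmorph1).
Qed.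
Lemma map_blk (X Y : 'M[A]_3) : map_mx f (blk X Y) = blk (map_mx f X) (map_mx f Y).
Proof. by rewrite /blk map_mxB !map_mxM !map_hat !map_mxM. Qed.
End Morphisms.

(** * Permuted block decompositions *)

Section Reorder.
Variable A : comNzRingType.
Definition reorder (s t : 'S_6) (W : 'M[A]_6) : 'M[A]_6 := \matrix_(i, j) W (s i) (t j).

Lemma reorderK s t : cancel (reorder s t) (reorder (s^-1)%g (t^-1)%g).
Proof. by move=> W; apply/matrixP => i j; rewrite !mxE !permKV. Qed.
Lemma reorderKV s t : cancel (reorder (s^-1)%g (t^-1)%g) (reorder s t).
Proof. by move=> W; apply/matrixP => i j; rewrite !mxE !permK. Qed.
Lemma reorderM s t u (W Y : 'M[A]_6) : reorder s t W *m reorder t u Y = reorder s u (W *m Y).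
Proof.
apply/matrixP => i j; rewrite !mxE [RHS](reindex_inj (@perm_inj _ t)).
by apply: eq_bigr => k _; rewrite !mxE.
Qed.
Lemma reorder_scalar s c : reorder s s c%:M = c%:M.
Proof. by apply/matrixP => i j; rewrite !mxE (inj_eq perm_inj). Qed.

Definition block_field (W Y : 'M[A]_(3 + 3)) : 'M[A]_6 :=
  block_mx (blk (ulsubmx W) (ulsubmx Y)) (- blk (ursubmx W) (dlsubmx Y))
           (- blk (dlsubmx W) (ursubmx Y)) (blk (drsubmx W) (drsubmx Y)).

(** The block field for rows reordered by [s] and columns by [t], transported back to the original
    order; the choice of [s] and [t] selects the motion. *)
Definition type_field s t (W Y : 'M[A]_6) :=
  reorder s^-1%g t^-1%g (block_field (reorder s t W) (reorder t s Y)).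
End Reorder.

Definition typeII (A : comNzRingType) (W Y : 'M[A]_6) :=
  [/\ forall i j, W i j * Y j i = 1, W *m Y = 6%:R%:M & Y *m W = 6%:R%:M].

Section AbstractFlow.
Variables (R A : idomainType) (eps : {rmorphism A -> R}) (D : A -> A) (u : A).
Hypothesis u6 : u * 6%:R = 1.
Hypothesis flow : forall (W0 Y0 : 'M[R]_(3 + 3)),
  (forall i j, W0 i j * Y0 j i = 1) -> W0 *m Y0 = 6%:R%:M -> Y0 *m W0 = 6%:R%:M ->
  exists W Y : 'M[A]_(3 + 3),
  [/\ map_mx eps W = W0 /\ map_mx eps Y = Y0, forall i j, W i j * Y j i = 1,
      W *m Y = 6%:R%:M &
      [/\ map_mx D (ulsubmx W) = blk (ulsubmx W) (ulsubmx Y),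
          map_mx D (ursubmx W) = - blk (ursubmx W) (dlsubmx Y),
          map_mx D (dlsubmx W) = - blk (dlsubmx W) (ursubmx Y) &
          map_mx D (drsubmx W) = blk (drsubmx W) (drsubmx Y)]].

Lemma reordered_flow (s t : 'S_6) (W0 Y0 : 'M[R]_6) : typeII W0 Y0 ->
  exists W Y : 'M[A]_6, [/\ map_mx eps W = W0, map_mx eps Y = Y0, typeII W Y &
      map_mx D W = type_field s t W Y].
Proof.
move=> [d0 WY0 YW0].
have [|||W [Y [[eW eY] d WY [d1 d2 d3 d4]]]] :=
    @flow (reorder s t W0) (reorder t s Y0).
- by move=> i j; rewrite !mxE d0.
- by rewrite reorderM WY0 reorder_scalar.
- by rewrite reorderM YW0 reorder_scalar.
(* [u] is 1/6, and a one-sided inverse of a square matrix is two-sided. *)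
have YW : Y *m W = 6%:R%:M.
  have YW1 : (u *: Y) *m W = 1%:M.
    by apply: mulmx1C; rewrite -scalemxAr WY scale_scalar_mx u6.
  have -> : Y = 6%:R *: (u *: Y) by rewrite scalerA mulrC u6 scale1r.
  by rewrite -scalemxAl YW1 scale_scalar_mx mulr1.
exists (reorder (s^-1)%g (t^-1)%g W), (reorder (t^-1)%g (s^-1)%g Y); split.
- by rewrite -[RHS](reorderK s t) -eW; apply/matrixP => i j; rewrite !mxE.
- by rewrite -[RHS](reorderK t s) -eY; apply/matrixP => i j; rewrite !mxE.
- split; first by move=> i j; rewrite !mxE d.
    by rewrite reorderM WY reorder_scalar.
  by rewrite reorderM YW reorder_scalar.
rewrite /type_field !reorderKV /block_field -d1 -d2 -d3 -d4 -map_block_mx.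
by rewrite submxK; apply/matrixP => i j; rewrite !mxE.
Qed.
End AbstractFlow.

Section Family.
Variables (F : fieldType) (charF : [pchar F] =i pred0).

Lemma fps_reordered_flow (R : idomainType) (iota : {rmorphism F -> R}) (s t : 'S_6)
  (W0 Y0 : 'M[R]_6) : typeII W0 Y0 ->
  exists W Y : 'M[fps R]_6,
  [/\ map_mx (@fps0 R) W = W0, map_mx (@fps0 R) Y = Y0, typeII W Y &
      map_mx (@fps_deriv R) W = type_field s t W Y].
Proof.
apply: (@reordered_flow R (fps R) (@fps0 R) (@fps_deriv R) (fpsC (iota 6%:R^-1))).
  rewrite -(rmorph_nat (@fpsC R)) -rmorphM -(rmorph_nat iota) -rmorphM mulVf ?rmorph1 //.
  by move/pcharf0P: charF => ->.
have D6 : fps_deriv (6%:R : fps R) = 0 by rewrite -(rmorph_nat (@fpsC R)) der_fpsC.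
move=> W0' Y0' h1 h2 h3.
apply: (@typeII_flow R (fps R) (@fpsC R) (@fps0 R) (@fps_deriv R) (@fps_derivP R)
  (block_flow iota charF) (flow_unique iota charF) (linear_unique iota charF)
  6%:R D6 W0' Y0' 6%:R _ _ h1 h2 h3); by rewrite rmorph_nat.
Qed.
End Family.

Section MapTypeField.
Variables (A B : comNzRingType) (f : {rmorphism A -> B}).

Lemma map_reorder s t (W : 'M[A]_6) : map_mx f (reorder s t W) = reorder s t (map_mx f W).
Proof. by apply/matrixP => i j; rewrite !mxE. Qed.

Lemma map_type_field s t (W Y : 'M[A]_6) :
  map_mx f (type_field s t W Y) = type_field s t (map_mx f W) (map_mx f Y).
Proof.
rewrite /type_field map_reorder; congr (reorder _ _ _).
rewrite /block_field -!map_reorder.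
move: (reorder s t W) (reorder t s Y) => M N.
rewrite (map_block_mx f (blk _ _)) !map_mxN !map_blk.
by rewrite -!map_ulsubmx -!map_ursubmx -!map_dlsubmx -!map_drsubmx.
Qed.
End MapTypeField.

(** * Composition of flows *)

Section Deformations.
Variables (F : fieldType) (charF : [pchar F] =i pred0) (W0 Y0 : 'M[F]_6).
Hypothesis WY0 : typeII W0 Y0.

(** A family of type II matrices through [W0] with prescribed tangent vectors: [eps] evaluates at
    the base point, and the derivations [D a] over [F] play the role of the directions. *)
Definition deformation (s : seq 'M[F]_6) : Prop :=
  exists (R : idomainType) (iota : {rmorphism F -> R}) (eps : {rmorphism R -> F})
    (D : nat -> R -> R) (W Y : 'M[R]_6),
  [/\ cancel iota eps, forall a, derivation (D a) /\ forall c, D a (iota c) = 0,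
      typeII W Y, map_mx eps W = W0 /\ map_mx eps Y = Y0 &
      forall a, (a < size s)%N -> map_mx eps (map_mx (D a) W) = nth 0 s a].

Lemma deformation0 : deformation [::].
Proof.
exists F, idfun, idfun, (fun _ _ => 0), W0, Y0; split=> //.
- by move=> _; split=> //; split=> *; rewrite ?addr0 // mul0r mulr0 addr0.
- by split; apply/matrixP => i j; rewrite !mxE.
Qed.

(** The flow starts from the deformed matrix [W] over [R], not from [W0]. The derivation in the new
    variable gives the new motion; the old derivations act on coefficients, and at the value 0 of
    the variable they act on [W] as before. *)
Lemma deformation_cons s t v :
  deformation v -> deformation (type_field s t W0 Y0 :: v).
Proof.
case=> R [iota [eps [D [W [Y [ie dD WY [eW eY] dW]]]]]].
have [W' [Y' [W'0 Y'0 WY' dW']]] := fps_reordered_flow charF iota s t WY.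
pose iota' : {rmorphism F -> fps R} := (@fpsC R) \o iota.
pose eps' : {rmorphism fps R -> F} := eps \o (@fps0 R).
have eps'E n m (M : 'M[fps R]_(n, m)) : map_mx eps' M = map_mx eps (map_mx (@fps0 R) M).
  by rewrite -map_mx_comp.
exists (fps R), iota', eps', (fun a => if a is b.+1 then fps_map (D b) else @fps_deriv R),
  W', Y'; split=> //.
- move=> [|a]; split.
  + exact: fps_derivP.
  + by move=> c; exact: der_fpsC.
  + by apply: fps_map_der; case: (dD a).
  move=> c; have [da d0] := dD a; apply/fpsP => -[|k]; rewrite fcoef0 /=; first exact: d0.
  exact: der0.
- by rewrite !eps'E W'0 Y'0.
case=> [|a] /= ha.
  by rewrite eps'E dW' !map_type_field W'0 Y'0 eW eY.
rewrite -dW // -W'0; apply/matrixP => i j; rewrite !mxE //.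
Qed.

End Deformations.

(** * Motions of the Fourier matrix *)

Section EisensteinArithmetic.

(* The pair (a, b) stands for a + b z, where z ^+ 2 = z - 1. *)
Definition eis := (int * int)%type.
Definition eadd (x y : eis) : eis := (x.1 + y.1, x.2 + y.2).
Definition eopp (x : eis) : eis := (- x.1, - x.2).
Definition emul (x y : eis) : eis :=
  (x.1 * y.1 - x.2 * y.2, x.1 * y.2 + x.2 * y.1 + x.2 * y.2).
Definition epow n : eis :=
  nth (1, 0) [:: (1, 0); (0, 1); (-1, 1); (-1, 0); (0, -1); (1, -1)] (n %% 6).
Definition esum (f : nat -> eis) := eadd (f 0%N) (eadd (f 1%N) (f 2)).

Definition ehat (M : nat -> nat -> eis) i j : eis :=
  if i == j then (0, 0) else
  let m := (3 - i - j)%N in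
  emul (emul (M i j) (eadd (1, 0) (eopp (emul (M i m) (M m i)))))
       (eadd (1, 0) (eopp (emul (M j m) (M m j)))).

(** [I] and [K] list the rows and the columns of a 3 x 3 block of the Fourier matrix; as
    [z ^+ 6 = 1], the factor 5 in the exponent inverts an entry. *)
Definition eblk (I K : nat -> nat) i k : eis :=
  let E a b := epow (I a * K b) in let E' b a := epow (5 * (I a * K b)) in
  let M a c := esum (fun b => emul (E a b) (E' b c)) in
  let N b d := esum (fun a => emul (E' b a) (E a d)) in
  eadd (esum (fun m => emul (ehat M i m) (E m k)))
       (eopp (esum (fun m => emul (E i m) (ehat N m k)))).

(** Computable counterpart of [type_field] at the Fourier matrix, for involutions [s] and [t]; [f]
    enumerates the lower or the upper half of the indices. *)
Definition efield (s t : nat -> nat) i j : eis :=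
  let p := s i in let q := t j in
  let f (h : bool) a := (if h then a else a + 3)%N in
  let b := eblk (fun a => s (f (p < 3)%N a)) (fun a => t (f (q < 3)%N a))
    (p %% 3)%N (q %% 3)%N in
  if (p < 3)%N == (q < 3)%N then b else eopp b.

Variables (A : comNzRingType) (z : A).
Hypothesis z2 : z ^+ 2 = z - 1.
Definition eval_eis (x : eis) : A := x.1%:~R + x.2%:~R * z.

Lemma eval_eadd x y : eval_eis (eadd x y) = eval_eis x + eval_eis y.
Proof. rewrite /eval_eis /= !rmorphD /=; ring. Qed.
Lemma eval_eopp x : eval_eis (eopp x) = - eval_eis x.
Proof. rewrite /eval_eis /= !rmorphN /=; ring. Qed.
Lemma eval_emul x y : eval_eis (emul x y) = eval_eis x * eval_eis y.
Proof.
rewrite /eval_eis /= !(rmorphB, rmorphD, rmorphM) /=.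
transitivity (x.1%:~R * y.1%:~R + (x.1%:~R * y.2%:~R + x.2%:~R * y.1%:~R) * z +
  x.2%:~R * y.2%:~R * z ^+ 2); first (rewrite z2; ring).
ring.
Qed.
Lemma eval_epow n : eval_eis (epow n) = z ^+ n.
Proof.
have z3 : z ^+ 3 = -1 by rewrite exprS z2 mulrBr mulr1 -expr2 z2 addrAC subrr sub0r.
have z6 : z ^+ 6 = 1 by rewrite (exprM z 3 2) z3 sqrrN expr1n.
rewrite {2}(divn_eq n 6) exprD mulnC exprM z6 expr1n mul1r /epow.
have : (n %% 6 < 6)%N by rewrite ltn_mod.
case: (n %% 6)%N => [|[|[|[|[|[|//]]]]]] _; rewrite /eval_eis /= ?expr0 ?expr1.
- by rewrite mul0r addr0.
- by rewrite mul1r add0r.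
- by rewrite z2 mul1r rmorphN1 addrC.
- by rewrite z3 mul0r addr0 rmorphN1.
- by rewrite exprS z3 mulrN1 rmorphN1 mulN1r add0r.
- by rewrite (exprD z 2 3) z3 z2 rmorphN1 mulN1r mulrN1 opprB.
Qed.

Lemma eval_esum (f : nat -> eis) (g : 'I_3 -> A) :
  (forall i : 'I_3, eval_eis (f i) = g i) -> eval_eis (esum f) = \sum_i g i.
Proof.
move=> fg; rewrite /esum !eval_eadd !big_ord_recl big_ord0 addr0.
by congr (_ + (_ + _)); rewrite -fg.
Qed.

Lemma eval_ehat (f : nat -> nat -> eis) (M : 'M[A]_3) :
  (forall i j : 'I_3, eval_eis (f i j) = M i j) ->
  forall i j : 'I_3, eval_eis (ehat f i j) = hat M i j.
Proof.
move=> fM i j; rewrite mxE /ehat.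
have -> : (i == j :> nat) = (i == j) by [].
case: eqVneq => [_|ij]; first by rewrite /eval_eis mul0r addr0.
have m3 : (3 - i - j)%N = third i j by move: i j ij => [[|[|[|//]]] ?] [[|[|[|//]]] ?].
by rewrite m3 /hat3 !eval_emul !eval_eadd !eval_eopp !eval_emul !fM
  /eval_eis /= mul0r addr0.
Qed.

Lemma eval_eblk (I K : nat -> nat) (X Y : 'M[A]_3) :
  (forall i k : 'I_3, X i k = z ^+ (I i * K k)) ->
  (forall k i : 'I_3, Y k i = z ^+ (5 * (I i * K k))) ->
  forall i k : 'I_3, eval_eis (eblk I K i k) = blk X Y i k.
Proof.
move=> XE YE i k; rewrite /eblk eval_eadd eval_eopp /blk !mxE; congr (_ - _).
  apply: eval_esum => m; rewrite eval_emul eval_epow XE; congr (_ * _).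
  apply: eval_ehat => a b; rewrite mxE; apply: eval_esum => l.
  by rewrite eval_emul !eval_epow XE YE.
apply: eval_esum => m; rewrite eval_emul eval_epow XE; congr (_ * _).
apply: eval_ehat => a b; rewrite mxE; apply: eval_esum => l.
by rewrite eval_emul !eval_epow XE YE.
Qed.

Definition fourier : 'M[A]_6 := \matrix_(i, j) z ^+ (i * j).
Definition fourierV : 'M[A]_6 := \matrix_(j, i) z ^+ (5 * (i * j)).

Lemma eval_efield (s t : 'S_6) (f g : nat -> nat) :
  (s^-1 = s)%g -> (t^-1 = t)%g -> (forall i, s i = f i :> nat) -> (forall i, t i = g i :> nat) ->
  forall i j : 'I_6, type_field s t fourier fourierV i j = eval_eis (efield f g i j).
Proof.
move=> sV tV sf tg i j; rewrite /type_field sV tV mxE /efield -sf -tg.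
have mL (a : 'I_3) : (@nat_of_ord 6 (lshift 3 a) %% 3 = a)%N by exact: modn_small (ltn_ord a).
have mR (a : 'I_3) : (@nat_of_ord 6 (rshift 3 a) %% 3 = a)%N by move: a => [[|[|[|//]]] ?].
have fl (a : 'I_3) : s (lshift 3 a) = f a :> nat by rewrite sf.
have fr (a : 'I_3) : s (rshift 3 a) = f (a + 3)%N :> nat by rewrite sf addnC.
have gl (a : 'I_3) : t (lshift 3 a) = g a :> nat by rewrite tg.
have gr (a : 'I_3) : t (rshift 3 a) = g (a + 3)%N :> nat by rewrite tg addnC.
rewrite /block_field.
case: (@split_ordP 3 3 (s i)) => a ->; case: (@split_ordP 3 3 (t j)) => b ->.
- rewrite (@block_mxEul A 3 3 3 3) !mL eqxx; apply/esym/eval_eblk => c d.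
    by rewrite !mxE fl gl.
  by rewrite !mxE fl gl.
- rewrite (@block_mxEur A 3 3 3 3) mxE !(mL, mR) /= eval_eopp; congr (- _).
  apply/esym/eval_eblk => c d; by rewrite !mxE fl gr.
- rewrite (@block_mxEdl A 3 3 3 3) mxE !(mL, mR) /= eval_eopp; congr (- _).
  apply/esym/eval_eblk => c d; by rewrite !mxE fr gl.
- rewrite (@block_mxEdr A 3 3 3 3) !mR eqxx; apply/esym/eval_eblk => c d; by rewrite !mxE fr gr.
Qed.
End EisensteinArithmetic.

(** * Four first-order motions *)

Section FourierDeformation.

Definition swap (b n : nat) : nat := if n == 2 then b else if n == b then 2%N else n.

(** The four motions divided by the entries of the Fourier matrix. Up to the factor 3 or -3, each is
    the sign character in one index times a sequence of period 3 and sum 0 in the other. *)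
Definition log_field (a i j : nat) : int :=
  let c1 n := nth 0 [:: 1; 0; -1; 1; 0; -1] n in
  let c2 n := nth 0 [:: 0; 1; -1; 0; 1; -1] n in
  match a with
  | 0%N => 3 * (-1) ^+ i * c1 j
  | 1%N => 3 * (-1) ^+ i * c2 j
  | 2%N => - 3 * (-1) ^+ j * c1 i
  | _ => - 3 * (-1) ^+ j * c2 i
  end.

Definition log_field_spec s t a :=
  all (fun i => all (fun j => efield s t i j == emul (epow (i * j)) (log_field a i j, 0))
    (iota 0 6)) (iota 0 6).

Lemma log_field_specP : [&& log_field_spec id (swap 3) 0, log_field_spec id (swap 4) 1,
  log_field_spec (swap 3) id 2 & log_field_spec (swap 4) id 3].
Proof. by vm_compute. Qed.

Lemma fourier_gram_spec : all (fun i => all (fun j =>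
  (\big[eadd/(0, 0)]_(k <- iota 0 6) epow (i * k + 5 * (j * k))) ==
  ((if i == j then 6 else 0), 0)) (iota 0 6)) (iota 0 6).
Proof. by rewrite unlock; vm_compute. Qed.

Section Typed.
Variables (A : comNzRingType) (z : A).
Hypothesis z2 : z ^+ 2 = z - 1.

Lemma fourier_typeII : typeII (fourier z) (fourierV z).
Proof.
have gram (i j : 'I_6) : \sum_(k < 6) z ^+ (i * k + 5 * (j * k)) = (6 *+ (i == j)).
  have /allP/(_ i) := fourier_gram_spec; rewrite mem_iota ltn_ord => /(_ isT).
  move=> /allP/(_ j); rewrite mem_iota ltn_ord => /(_ isT) /eqP/(congr1 (eval_eis z)).
  have evs (r : seq nat) (f : nat -> eis) : eval_eis z (\big[eadd/(0, 0)]_(k <- r) f k) =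
    \sum_(k <- r) eval_eis z (f k).
    by elim/big_rec2: _ => [|k x y _ <-]; rewrite ?eval_eadd // /eval_eis mul0r addr0.
  rewrite evs -[iota 0 6]/(index_iota 0 6) big_mkord; under eq_bigr do rewrite (eval_epow z2).
  by move=> ->; rewrite /eval_eis mul0r addr0 -val_eqE; case: eqP => _ /=.
have z6 : z ^+ 6 = 1 by rewrite -(eval_epow z2) /eval_eis /= mul0r addr0.
split=> [i j||].
- rewrite !mxE -exprD -mulSn exprM z6 expr1n //.
- apply/matrixP => i j; rewrite !mxE -gram; apply: eq_bigr => k _.
  by rewrite !mxE -exprD.
apply/matrixP => i j; rewrite !mxE eq_sym -gram; apply: eq_bigr => k _.
by rewrite !mxE -exprD addnC mulnC [(k * i)%N]mulnC.
Qed.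

Lemma log_field_type_field (s t : 'S_6) (f g : nat -> nat) a :
  (s^-1 = s)%g -> (t^-1 = t)%g -> (forall i, s i = f i :> nat) -> (forall i, t i = g i :> nat) ->
  log_field_spec f g a -> forall i j : 'I_6,
  type_field s t (fourier z) (fourierV z) i j = z ^+ (i * j) * (log_field a i j)%:~R.
Proof.
move=> sV tV sf tg /allP spec i j; rewrite (eval_efield z2 sV tV sf tg).
move: (spec i); rewrite mem_iota ltn_ord => /(_ isT) /allP/(_ j).
rewrite mem_iota ltn_ord => /(_ isT) /eqP ->.
by rewrite (eval_emul z2) (eval_epow z2) /eval_eis /= mul0r addr0.
Qed.
End Typed.

Definition swap_perm (b : 'I_6) : 'S_6 := tperm (inord 2) b.
Lemma swap_permE (b : 'I_6) (i : 'I_6) : swap_perm b i = swap b i :> nat.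
Proof.
rewrite /swap_perm permE /= /swap -!val_eqE /= inordK //.
by do 2!case: ifP => _ //; rewrite inordK.
Qed.

Lemma fourier_deformation (F : fieldType) (z : F) : [pchar F] =i pred0 -> z ^+ 2 = z - 1 ->
  exists (R : idomainType) (iota : {rmorphism F -> R}) (eps : {rmorphism R -> F})
    (D : 'I_4 -> R -> R) (W Y : 'M[R]_6),
  [/\ cancel iota eps, forall a, derivation (D a) /\ forall c, D a (iota c) = 0,
      typeII W Y, map_mx eps W = fourier z /\ map_mx eps Y = fourierV z &
      forall a i j, eps (D a (W i j)) = z ^+ (i * j) * (log_field a i j)%:~R].
Proof.
move=> charF z2; have WY0 := fourier_typeII z2.
(* The index 2 is exchanged with 3 or 4, first among the columns, then among the rows. *)
have e : deformation (fourier z) (fourierV z)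
  [:: type_field 1 (swap_perm (inord 3)) (fourier z) (fourierV z);
      type_field 1 (swap_perm (inord 4)) (fourier z) (fourierV z);
      type_field (swap_perm (inord 3)) 1 (fourier z) (fourierV z);
      type_field (swap_perm (inord 4)) 1 (fourier z) (fourierV z)].
  by do 4!apply: (deformation_cons charF); exact: deformation0.
case: e => R [iota [eps [D [W [Y [ie dD WY WY0' dW]]]]]].
exists R, iota, eps, (fun a : 'I_4 => D a), W, Y; split=> // a i j.
have := dW a (ltn_ord a) => /matrixP/(_ i j); rewrite !mxE => ->.
have sV b : ((swap_perm b)^-1 = swap_perm b)%g by rewrite tpermV.
have idE (i' : 'I_6) : (1%g : 'S_6) i' = id i' :> nat by rewrite perm1.
have sE b (hb : (b < 6)%N) (i' : 'I_6) : swap_perm (inord b) i' = swap b i' :> nat.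
  by rewrite swap_permE inordK.
have /and4P[s1 s2 s3 s4] := log_field_specP.
case: a => [[|[|[|[|//]]]] ha] /=.
- exact: (log_field_type_field z2 (invg1 _) (sV _) idE (sE _ _) s1).
- exact: (log_field_type_field z2 (invg1 _) (sV _) idE (sE _ _) s2).
- exact: (log_field_type_field z2 (sV _) (invg1 _) (sE _ _) idE s3).
- exact: (log_field_type_field z2 (sV _) (invg1 _) (sE _ _) idE s4).
Qed.

End FourierDeformation.

(** * Specialization of generic points *)

Section Specialization.
Variables (F : closedFieldType) (R : idomainType) (iota : {rmorphism F -> R}).

(* For A built by adjoining finitely many elements to F, this is the Nullstellensatz
   for the domain [ev A]. *)
Definition specializable (A : idomainType) (j : {rmorphism F -> A}) (ev : {rmorphism A -> R}) :=
  forall h, ev h != 0 -> exists psi : {rmorphism A -> F},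
    [/\ cancel j psi, psi h != 0 & forall p, ev p = 0 -> psi p = 0].

Lemma specializable_base : specializable (idfun : {rmorphism F -> F}) iota.
Proof.
move=> h ih; exists idfun; split=> //.
  by apply: contraNneq ih => /= ->; rewrite rmorph0.
by move=> p /eqP; rewrite fmorph_eq0 => /eqP.
Qed.

Section Step.
Variables (A : idomainType) (j : {rmorphism F -> A}) (ev : {rmorphism A -> R}) (w : R).
Hypothesis specA : specializable j ev.
Let evw (p : {poly A}) : R := (map_poly ev p).[w].

Lemma image_min (P : {poly A} -> Prop) : (exists2 p, P p & map_poly ev p != 0) ->
  exists2 p, P p /\ map_poly ev p != 0 &
    forall q, P q -> map_poly ev q != 0 -> (size (map_poly ev p) <= size (map_poly ev q))%N.
Proof.
case=> p Pp p0; have ex : exists n,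
    `[< exists q, [/\ P q, map_poly ev q != 0 & size (map_poly ev q) = n] >].
  by exists (size (map_poly ev p)); apply/asboolP; exists p.
case: (ex_minnP ex) => n /asboolP[q [Pq q0 sq]] mn; exists q => // r Pr r0.
by rewrite sq; apply: mn; apply/asboolP; exists r.
Qed.

(** [ev] may kill leading coefficients. Truncation at the degree of the image makes the leading
    coefficient survive, so that pseudo-division descends to the image. *)
Definition cut (p : {poly A}) := take_poly (size (map_poly ev p)) p.

Lemma map_cut p : map_poly ev (cut p) = map_poly ev p.
Proof.
apply/polyP => i; rewrite !coef_map coef_take_poly; case: ltnP => // h.
by rewrite /= rmorph0 -coef_map nth_default.
Qed.

Lemma size_cut p : map_poly ev p != 0 -> size (cut p) = size (map_poly ev p).
Proof.
move=> p0; apply/eqP; rewrite eqn_leq size_take_poly -{1}map_cut /=.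
exact: size_poly.
Qed.

Lemma cut_lead p : map_poly ev p != 0 -> ev (lead_coef (cut p)) != 0.
Proof.
move=> p0; rewrite lead_coefE size_cut // -coef_map map_cut -lead_coefE.
by rewrite lead_coef_eq0.
Qed.

Lemma map_divp_cut p q : map_poly ev p != 0 -> let k := scalp q (cut p) in
  ev (lead_coef (cut p)) ^+ k *: map_poly ev q =
    map_poly ev (q %/ cut p) * map_poly ev p + map_poly ev (q %% cut p) /\
  (size (map_poly ev (q %% cut p)) < size (map_poly ev p))%N.
Proof.
move=> p0 /=; split.
  have := congr1 (map_poly ev) (Pdiv.Idomain.divp_eq q (cut p)).
  by rewrite map_polyZ /= rmorphXn rmorphD rmorphM /= map_cut.
apply: leq_ltn_trans (size_poly _ _) _; rewrite -size_cut // ltn_modp.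
by rewrite -size_poly_eq0 size_cut // size_poly_eq0.
Qed.

(** An algebraic [w] is sent to a root of its specialized minimal polynomial, a transcendental one
    to a value at which [h] stays nonzero. *)
Lemma specializable_poly_step h : evw h != 0 ->
  exists psi : {rmorphism A -> F}, exists t : F, [/\ cancel j psi,
    (map_poly psi h).[t] != 0 & forall p, evw p = 0 -> (map_poly psi p).[t] = 0].
Proof.
move=> h0; have [alg|trans] := pselect (exists2 p, evw p = 0 & map_poly ev p != 0).
  have [m [mK m0] mmin] := image_min alg.
  (* [J] is the ideal generated by [h] and [m]; an element [s] of least image degree acts as their
     gcd. *)
  pose J p := exists u v, p = u * h + v * m.
  have mJ : J m by exists 0, 1; rewrite mul0r add0r mul1r.
  have hJ : J h by exists 1, 0; rewrite mul0r addr0 mul1r.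
  have [s [[u [v sE]] s0] smin] := image_min (ex_intro2 _ _ m mJ m0).
  have ds q : J q -> exists k, ev (lead_coef (cut s)) ^+ k *: map_poly ev q =
      map_poly ev (q %/ cut s) * map_poly ev s.
    move=> [a [b qE]]; have /= := map_divp_cut q s0; set k := scalp _ _.
    case=> e lt; exists k; rewrite e; apply/eqP; rewrite -subr_eq0 addrAC subrr add0r.
    apply: contraLR lt => r0; rewrite -leqNgt.
    pose r := lead_coef (cut s) ^+ k *: q - (q %/ cut s) * s.
    have rE : map_poly ev (q %% cut s) = map_poly ev r.
      by rewrite /r rmorphB /= map_polyZ /= rmorphXn e rmorphM /= ?map_cut addrAC subrr add0r.
    rewrite rE; apply: smin; last by rewrite -rE.
    exists (lead_coef (cut s) ^+ k *: a - (q %/ cut s) * u),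
      (lead_coef (cut s) ^+ k *: b - (q %/ cut s) * v).
    by rewrite /r {1}qE sE -!mul_polyC; ring.
  have [km kmE] := ds m mJ; have [kh khE] := ds h hJ.
  have c0 := cut_lead s0.
  have sw : evw s != 0.
    apply: contra_neq h0 => sw; have := congr1 (fun p => p.[w]) khE.
    rewrite hornerZ hornerM -/(evw s) sw mulr0 => /eqP; rewrite mulf_eq0.
    by rewrite expf_eq0 (negPf c0) andbF => /eqP.
  have qK : evw (m %/ cut s) = 0.
    have := congr1 (fun p => p.[w]) kmE.
    rewrite hornerZ hornerM -/(evw s) -/(evw m) mK mulr0 => /esym/eqP.
    by rewrite mulf_eq0 (negPf sw) orbF => /eqP.
  have q0 : map_poly ev (m %/ cut s) != 0.
    apply: contraNneq m0 => q0; move/eqP: kmE; rewrite q0 mul0r scale_poly_eq0.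
    by rewrite expf_eq0 (negPf c0) andbF.
  (* If [s] were not constant, the cofactor of [s] in [m] would vanish at [w] and have smaller
     degree than [m]. *)
  have s1 : size (map_poly ev s) = 1%N.
    have := congr1 (size \o polyseq) kmE; rewrite /= size_scale ?expf_neq0 // size_mul //.
    have := mmin _ qK q0; have : size (map_poly ev s) != 0%N by rewrite size_poly_eq0.
    case: (size (map_poly ev s)) => [//|[//|n]] _ le e; move: le; rewrite e !addnS /=.
    by rewrite leqNgt ltnS leq_addr.
  have m1 : (1 < size (map_poly ev m))%N.
    apply: (@root_size_gt1 _ w) => //; exact/rootP.
  pose a := lead_coef (cut m); have a0 : ev a != 0 := cut_lead m0.
  have b0 : ev s`_0 != 0.
    by rewrite -coef_map -[0%N]/(1.-1)%N -s1 -lead_coefE lead_coef_eq0.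
  (* The leading coefficient of [m] must survive to provide a root and to allow division by [m]; the
     constant [s] must survive to keep [h] nonzero at the root. *)
  have [|psi [psij psih psiK]] := specA (h := a * s`_0).
    by rewrite rmorphM mulf_neq0.
  move: psih; rewrite rmorphM mulf_eq0 negb_or => /andP[pa pb].
  have psi_ev p q : map_poly ev p = map_poly ev q -> map_poly psi p = map_poly psi q.
    move=> e; apply/polyP => i; rewrite !coef_map; apply/eqP; rewrite -subr_eq0 -rmorphB.
    by apply/eqP/psiK; rewrite rmorphB /= -!(coef_map ev) e subrr.
  have szm : size (map_poly psi (cut m)) = size (map_poly ev m).
    by rewrite size_map_poly_id0 ?size_cut //.
  have [t /rootP tm] : exists t, root (map_poly psi (cut m)) t.
    by apply/closed_rootP; rewrite szm; case: size m1 => [|[]].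
  exists psi, t; split=> //.
    apply: contraNneq pb => ht.
    have : map_poly psi s = (psi s`_0)%:P.
      rewrite -map_polyC; apply: psi_ev; rewrite map_polyC /=.
      by rewrite [LHS]size1_polyC ?s1 // coef_map.
    move/(congr1 (fun p => p.[t])); rewrite hornerC => <-.
    rewrite sE rmorphD !rmorphM /= hornerD !hornerM ht mulr0 add0r.
    by rewrite -(psi_ev _ _ (map_cut m)) tm mulr0.
  move=> p pK; have /= := map_divp_cut p m0; set k := scalp _ _; case=> e lt.
  have r0 : map_poly ev (p %% cut m) = 0.
    apply: contraTeq lt => r0; rewrite -leqNgt; apply: mmin => //.
    have := congr1 (fun p => p.[w]) e.
    by rewrite hornerZ hornerD hornerM -/(evw m) -/(evw p) mK pK !mulr0 add0r.
  have := congr1 (map_poly psi) (Pdiv.Idomain.divp_eq p (cut m)).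
  rewrite map_polyZ rmorphD rmorphM /= rmorphXn.
  rewrite (psi_ev (p %% cut m) 0) ?rmorph0 ?addr0 // => /(congr1 (fun q => q.[t])).
  rewrite hornerZ hornerM tm mulr0 => /eqP; rewrite mulf_eq0 expf_eq0 (negPf pa) andbF.
  by move/eqP.
(* In the transcendental case it suffices to keep the leading coefficient of [h] nonzero. *)
have K p : evw p = 0 -> map_poly ev p = 0.
  by move=> pK; apply: contrapT => /eqP p0; apply: trans; exists p.
have hm0 : map_poly ev h != 0 by apply: contraNneq h0; rewrite /evw => ->; rewrite horner0.
have [|psi [psij psih psiK]] := specA (h := h`_(size (map_poly ev h)).-1).
  by rewrite -coef_map -lead_coefE lead_coef_eq0.
have ph0 : map_poly psi h != 0.
  by apply: contraNneq psih => /polyP/(_ (size (map_poly ev h)).-1); rewrite coef_map coef0 => ->.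
have [t /rootP/eqP pt] := elimT (closed_nonrootP _) ph0.
exists psi, t; split=> //.
move=> p /K pK; suff -> : map_poly psi p = 0 by rewrite horner0.
apply/polyP => i; rewrite coef_map coef0; apply: psiK.
by rewrite -coef_map pK coef0.
Qed.

End Step.

Lemma specializable_tower (w : nat -> R) n : exists (A : idomainType)
  (j : {rmorphism F -> A}) (ev : {rmorphism A -> R}) (x : nat -> A),
  [/\ forall c, ev (j c) = iota c, forall i, (i < n)%N -> ev (x i) = w i & specializable j ev].
Proof.
elim: n => [|n [A [j [ev [x [evj evx spec]]]]]].
  by exists F, idfun, iota, (fun=> 0); split=> //; exact: specializable_base.
pose j' : {rmorphism F -> {poly A}} := @polyC A \o j.
pose ev' : {rmorphism {poly A} -> R} := horner_eval (w n) \o map_poly ev.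
exists {poly A}, j', ev', (fun i => if i == n then 'X else (x i)%:P); split.
- by move=> c; rewrite /ev' /= map_polyC /= /horner_eval hornerC.
- move=> i; rewrite ltnS leq_eqVlt /ev' /= /horner_eval.
  case: eqP => [-> _|_ /= /evx <-]; first by rewrite map_polyX hornerX.
  by rewrite map_polyC hornerC.
move=> h h0; have [psi [t [psij ph pK]]] := specializable_poly_step spec h0.
exists (horner_eval t \o map_poly psi); split=> // c.
by rewrite /j' /= map_polyC /horner_eval hornerC; exact: psij.
Qed.

Lemma rmorph_mmap n (A B : comNzRingType) (j : {rmorphism F -> A}) (f : {rmorphism A -> B})
  (x : 'I_n -> A) (p : {mpoly F[n]}) : f (mmap j x p) = mmap (f \o j) (f \o x) p.
Proof.
rewrite /mmap rmorph_sum; apply: eq_bigr => m _; rewrite rmorphM /= /mmap1 rmorph_prod.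
by congr (_ * _); apply: eq_bigr => i _; rewrite rmorphXn.
Qed.

Lemma eq_mmap n (B : comNzRingType) (j j' : F -> B) (x x' : 'I_n -> B) (p : {mpoly F[n]}) :
  j =1 j' -> x =1 x' -> mmap j x p = mmap j' x' p.
Proof.
move=> jj xx; rewrite /mmap; apply: eq_bigr => m _; rewrite jj; congr (_ * _).
by apply: eq_bigr => i _; rewrite xx.
Qed.

Lemma specialization n (w : 'I_n -> R) (h : {mpoly F[n]}) : mmap iota w h != 0 ->
  exists2 y : 'I_n -> F, h.@[y] != 0 & forall p, mmap iota w p = 0 -> p.@[y] = 0.
Proof.
move=> h0; pose w' i := if insub i is Some k then w k else 0.
have [A [j [ev [x [evj evx spec]]]]] := specializable_tower w' n.
have evE p : ev (mmap j (fun i : 'I_n => x i) p) = mmap iota w p.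
  rewrite rmorph_mmap; apply: eq_mmap => i; first exact: evj.
  by rewrite /= evx // /w' valK.
have [|psi [psij psih psiK]] := spec (mmap j (fun i : 'I_n => x i) h); first by rewrite evE.
have psiE p : psi (mmap j (fun i : 'I_n => x i) p) = p.@[fun i => psi (x i)].
  by rewrite rmorph_mmap /meval; apply: eq_mmap => // c; exact: psij.
exists (fun i => psi (x i)); first by rewrite -psiE.
by move=> p p0; rewrite -psiE; apply: psiK; rewrite evE.
Qed.

End Specialization.

(** * The family of orthogonal pairs *)

Section PairFromMatrix.
Variables (s t : 'S_6).

(** [u] stands for 1/6. The first system consists of diagonal units, the second of multiples of
    column times row products; [s] and [t] account for arbitrary orderings. Any ring is allowed, so
    as to include the generic point. *)
Definition sys_entry (A : comNzRingType) (u : A) (W Y : 'M[A]_6) (k : entry_index) : A :=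
  let: (b, i, r, c) := k in
  if b then u * (W r (t i) * Y (t i) c) else ((r == s i) && (c == s i))%:R.

Lemma map_sys_entry (A B : comNzRingType) (f : {rmorphism A -> B}) u W Y k :
  f (sys_entry u W Y k) = sys_entry (f u) (map_mx f W) (map_mx f Y) k.
Proof.
by case: k => [[[b i] r] c] /=; case: b; rewrite ?rmorph_nat // !rmorphM !mxE.
Qed.

Section Opair.
Variables (F : fieldType).
Hypothesis F6 : (6%:R : F) != 0.
Variables (W Y : 'M[F]_6).
Hypothesis WY : typeII W Y.

Definition diag_proj (i : 'I_6) : 'M[F]_6 := delta_mx (s i) (s i).
Definition col_proj (j : 'I_6) : 'M[F]_6 := 6%:R^-1 *: (col (t j) W *m row (t j) Y).

Lemma col_projE j r c : col_proj j r c = 6%:R^-1 * (W r (t j) * Y (t j) c).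
Proof. by rewrite !mxE big_ord_recl big_ord0 !mxE addr0. Qed.

Lemma row_col_gram j j' : row j Y *m col j' W = (6%:R *+ (j == j'))%:M.
Proof.
case: WY => _ _ YW; apply/matrixP => a b; rewrite !ord1 !mxE eqxx mulr1n.
have := congr1 (fun M : 'M_6 => M j j') YW; rewrite !mxE => <-.
by apply: eq_bigr => k _; rewrite !mxE.
Qed.

Lemma col_projM j j' : col_proj j *m col_proj j' = if j == j' then col_proj j else 0.
Proof.
rewrite /col_proj -scalemxAl -scalemxAr mulmxA -[_ *m row _ _ *m _]mulmxA.
rewrite row_col_gram mul_mx_scalar (inj_eq perm_inj); case: eqVneq => [<-|_].
  by rewrite mulr1n -scalemxAl [_ *: (6%:R *: _)]scalerA mulVf // scale1r.
by rewrite mulr0n scale0r mul0mx !scaler0.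
Qed.

Lemma col_proj_trace j : \tr (col_proj j) = 1.
Proof.
rewrite mxtraceZ mxtrace_mulC row_col_gram eqxx mxtrace_scalar !mulr1n.
by rewrite mulVf.
Qed.

Lemma col_proj_rank j : \rank (col_proj j) = 1%N.
Proof.
apply/eqP; rewrite eqn_leq lt0n mxrank_eq0 mxrank_scale_nz ?invr_eq0 //.
rewrite mulmx_max_rank /=; apply: contraTneq (oner_neq0 F) => Q0.
by rewrite -(col_proj_trace j) Q0 mxtrace0 eqxx.
Qed.

Lemma diag_projM i i' : diag_proj i *m diag_proj i' = if i == i' then diag_proj i else 0.
Proof.
rewrite /diag_proj; case: eqVneq => [->|ii]; first by rewrite mul_delta_mx.
by rewrite mul_delta_mx_0 // (inj_eq perm_inj).
Qed.

Lemma diag_col_trace i j : \tr (diag_proj i *m col_proj j) = 6%:R^-1.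
Proof.
rewrite /mxtrace (bigD1 (s i)) //= big1 => [|k ki]; rewrite mxE (bigD1 (s i)) //= big1.
- by rewrite !addr0 col_projE !mxE !eqxx mul1r; case: WY => -> _ _; rewrite mulr1.
- by move=> l li; rewrite mxE (negPf li) andbF mul0r.
- by rewrite addr0 mxE (negPf ki) mul0r.
by move=> l li; rewrite mxE (negPf li) andbF mul0r.
Qed.

Definition typeII_opair : opair F.
Proof.
apply: (@OPair F diag_proj col_proj).
- by move=> i; rewrite diag_projM eqxx.
- by move=> j; rewrite col_projM eqxx.
- by move=> i; apply: mxrank_delta.
- exact: col_proj_rank.
- by move=> i i' /negPf ii; rewrite diag_projM ii.
- by move=> j j' /negPf jj; rewrite col_projM jj.
- exact: diag_col_trace.
Defined.

Lemma entry_typeII_opair k : entry typeII_opair k = sys_entry 6%:R^-1 W Y k.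
Proof.
case: k => [[[b i] r] c] /=; case: b; first exact: col_projE.
by rewrite mxE.
Qed.
End Opair.

Section GenericPoint.
Variables (F : closedFieldType) (R : idomainType) (iota : {rmorphism F -> R}).
Hypothesis F6 : (6%:R : F) != 0.
Variables (W Y : 'M[R]_6).
Hypothesis WY : typeII W Y.

Definition generic_entry (k : 'I_#|entry_index|) : R :=
  sys_entry (iota 6%:R^-1) W Y (enum_val k).

Let V : finType := (bool * 'I_6 * 'I_6)%type.
Let w (v : 'I_#|V|) : R := let: (b, i, j) := enum_val v in if b then W i j else Y i j.

(** Otherwise the pullback [H] of [q] to the entries of [W] and [Y] would be nonzero at some
    specialization to [F]; the type II equations persist there, against the assumption. *)
Lemma generic_entry0 (q : {mpoly F[#|entry_index|]}) :
  (forall W' Y' : 'M[F]_6, typeII W' Y' ->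
    q.@[fun k => sys_entry 6%:R^-1 W' Y' (enum_val k)] = 0) ->
  mmap iota generic_entry q = 0.
Proof.
move=> q0; apply: contrapT => /eqP nz.
pose X (v : V) : {mpoly F[#|V|]} := 'X_(enum_rank v).
pose W1 := \matrix_(i, j) X (true, i, j); pose Y1 := \matrix_(i, j) X (false, i, j).
pose H := mmap (@mpolyC _ F) (fun k => sys_entry (6%:R^-1)%:MP W1 Y1 (enum_val k)) q.
have ev (B : comNzRingType) (f : {rmorphism F -> B}) (x : 'I_#|V| -> B) :
    mmap f x H = mmap f (fun k => sys_entry (f 6%:R^-1) (map_mx (mmap f x) W1)
      (map_mx (mmap f x) Y1) (enum_val k)) q.
  rewrite /H rmorph_mmap; apply: eq_mmap => k; first by rewrite /= mmapC.
  by rewrite /= map_sys_entry /= mmapC.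
have evX (B : comNzRingType) (f : {rmorphism F -> B}) (x : 'I_#|V| -> B) v :
  mmap f x (X v) = x (enum_rank v) by rewrite mmapX mmap1U.
have ev_iota (M : bool) : map_mx (mmap iota w) (if M then W1 else Y1) = if M then W else Y.
  by apply/matrixP => i j; case: M; rewrite !mxE evX /w enum_rankK.
have [|y Hy yK] := specialization (iota := iota) (w := w) (h := H).
  by rewrite ev (ev_iota true) (ev_iota false).
move/eqP: Hy; rewrite /meval ev; apply; apply: q0.
have rel (p p' : {mpoly F[#|V|]}) : mmap iota w p = mmap iota w p' ->
    mmap idfun y p = mmap idfun y p'.
  by move=> e; apply/eqP; rewrite -subr_eq0 -rmorphB; apply/eqP/yK; rewrite rmorphB /= e subrr.
case: WY => d WY1 YW1.
have [eW eY] := (ev_iota true, ev_iota false).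
split=> [i j||].
- rewrite !mxE -rmorphM -[RHS](rmorph1 (mmap (idfun : {rmorphism F -> F}) y)); apply: rel.
  have := d i j; rewrite -eW -eY !mxE => e.
  by rewrite rmorphM e rmorph1.
- rewrite -map_mxM; apply/matrixP => i j; rewrite [LHS]mxE [RHS]mxE.
  rewrite -(rmorph_nat (mmap (idfun : {rmorphism F -> F}) y)) -rmorphMn; apply: rel.
  have := congr1 (fun M : 'M_6 => M i j) WY1; rewrite -eW -eY -map_mxM mxE => ->.
  by rewrite mxE rmorphMn rmorph_nat.
rewrite -map_mxM; apply/matrixP => i j; rewrite [LHS]mxE [RHS]mxE.
rewrite -(rmorph_nat (mmap (idfun : {rmorphism F -> F}) y)) -rmorphMn; apply: rel.
have := congr1 (fun M : 'M_6 => M i j) YW1; rewrite -eW -eY -map_mxM mxE => ->.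
by rewrite mxE rmorphMn rmorph_nat.
Qed.
End GenericPoint.
End PairFromMatrix.

(** * The prime ideal of the generic point *)

Section GenericIdeal.
Variables (s t : 'S_6) (F : closedFieldType) (R : idomainType).
Variables (iota : {rmorphism F -> R}) (eps : {rmorphism R -> F}).
Hypothesis F6 : (6%:R : F) != 0.
Hypothesis epsK : cancel iota eps.
Variables (W Y : 'M[R]_6).
Hypothesis WY : typeII W Y.

Local Notation gen := (generic_entry s t iota W Y).
Local Notation entries x := (fun k => entry x (enum_val k)).

Lemma inv_regular_rep (f : invariants F) : exists p : {mpoly F[#|entry_index|]},
  forall x, f x = p.@[entries x].
Proof. by case: f => f /= /inv_regularP[]. Qed.

Definition generic_value (f : invariants F) : R := mmap iota gen (projT1 (cid (inv_regular_rep f))).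

(** Two representing polynomials differ by one vanishing at all pairs over [F], in particular at
    those from type II matrices, so [generic_entry0] applies. *)
Lemma generic_valueE (f : invariants F) p : (forall x, f x = p.@[entries x]) ->
  generic_value f = mmap iota gen p.
Proof.
rewrite /generic_value; case: cid => q /= qE pE; apply/eqP; rewrite -subr_eq0 -rmorphB.
apply/eqP/generic_entry0 => // W' Y' WY'.
have e := entry_typeII_opair s t F6 WY'.
rewrite -(meval_eq (v1 := entries (typeII_opair s t F6 WY'))) => [|k]; last exact: e.
by rewrite mevalB -qE -pE subrr.
Qed.

Lemma generic_value_peval n (p : {mpoly F[n]}) (f : 'I_n -> invariants F) :
  generic_value (peval p f) = mmap iota (fun i => generic_value (f i)) p.
Proof.
pose q i := projT1 (cid (inv_regular_rep (f i))).
rewrite (@generic_valueE _ (mmap (@mpolyC _ F) q p)).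
  by rewrite rmorph_mmap; apply: eq_mmap => // c; rewrite /= mmapC.
move=> x; rewrite /= {2}/meval rmorph_mmap; apply: eq_mmap => [c|i]; first by rewrite /= mmapC.
by rewrite /q /=; case: cid => qi /= ->.
Qed.

Lemma generic_valueD f g : generic_value (f + g) = generic_value f + generic_value g.
Proof.
rewrite (@generic_valueE (f + g) (projT1 (cid (inv_regular_rep f)) + projT1 (cid (inv_regular_rep g)))).
  exact: rmorphD.
by move=> x; rewrite mevalD; do 2!case: cid => ? /= <-.
Qed.

Lemma generic_valueM f g : generic_value (f * g) = generic_value f * generic_value g.
Proof.
rewrite (@generic_valueE (f * g) (projT1 (cid (inv_regular_rep f)) * projT1 (cid (inv_regular_rep g)))).
  exact: rmorphM.
by move=> x; rewrite mevalM; do 2!case: cid => ? /= <-.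
Qed.

Lemma generic_value0 : generic_value 0 = 0.
Proof. by rewrite (@generic_valueE 0 0) ?rmorph0 // => x; rewrite meval0. Qed.

Lemma generic_value1 : generic_value 1 = 1.
Proof. by rewrite (@generic_valueE 1 1) ?rmorph1 // => x; rewrite meval1. Qed.

Lemma generic_valueMn f n : generic_value (f *+ n) = generic_value f *+ n.
Proof.
by elim: n => [|n IH]; rewrite ?generic_value0 // !mulrS generic_valueD IH.
Qed.

Definition generic_ideal : set (invariants F) := [set f | generic_value f = 0].

Definition generic_spec : moduli F.
Proof.
apply: (@Spec _ generic_ideal); rewrite /generic_ideal /=.
- exact: generic_value0.
- by move=> f g; rewrite generic_valueD => -> ->; rewrite addr0.
- by move=> f g; rewrite generic_valueM => ->; rewrite mulr0.
- by rewrite generic_value1 => /eqP; rewrite oner_eq0.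
by move=> f g /eqP; rewrite generic_valueM mulf_eq0 => /orP[]/eqP; tauto.
Defined.

(** The closure of the point [generic_spec]. *)
Definition generic_family : set (moduli F) := [set Q | generic_ideal `<=` ideal_of Q].

Lemma generic_family_closed : zariski_closed generic_family.
Proof. by exists generic_ideal. Qed.

Lemma generic_spec_in : generic_family generic_spec. Proof. by []. Qed.

(** A closed set containing the generic point contains its closure. *)
Lemma generic_family_irreducible : irreducible generic_family.
Proof.
split; first by exists generic_spec.
move=> Z1 Z2 [S1 ->] [S2 ->] /(_ _ generic_spec_in) [] h; [left|right];
  by move=> Q /= gQ f /h /gQ.
Qed.

Lemma ideal_of_generic_family : ideal_of_set generic_family = generic_ideal.
Proof.
by apply/seteqP; split=> [f /(_ _ generic_spec_in)|f gf Q]; last exact.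
Qed.

Lemma generic_family_point x : (forall k, entry x (enum_val k) = eps (gen k)) ->
  generic_family (moduli_point x).
Proof.
move=> xE f; rewrite /generic_ideal /= => f0.
have [p pE] := inv_regular_rep f; rewrite pE.
have : eps (mmap iota gen p) = 0 by rewrite -(generic_valueE pE) f0 rmorph0.
by rewrite rmorph_mmap => <-; apply: eq_mmap => // c; rewrite /= epsK.
Qed.

Lemma generic_family_indep n (f : 'I_n -> invariants F) :
  alg_indep_mod (ideal_of_set generic_family) f <->
  forall p, mmap iota (fun i => generic_value (f i)) p = 0 -> p = 0.
Proof.
by rewrite ideal_of_generic_family /alg_indep_mod /generic_ideal /=; split=> h p;
  have := h p; rewrite generic_value_peval.
Qed.

(** At a pair given by a type II matrix, this is 1/36 times a cross ratio of four entries of the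
    matrix. *)
Definition cross_fun i j k l (x : opair F) : F :=
  \tr (fst_sys x i *m snd_sys x j *m fst_sys x k *m snd_sys x l).

Definition entry_poly b i : 'M[{mpoly F[#|entry_index|]}]_6 :=
  \matrix_(r, c) 'X_(enum_rank (b, i, r, c) : 'I_#|entry_index|).
Definition cross_poly i j k l : {mpoly F[#|entry_index|]} :=
  \tr (entry_poly false i *m entry_poly true j *m entry_poly false k *m entry_poly true l).

Lemma mmap_cross_poly (B : comNzRingType) (f : {rmorphism F -> B}) (x : 'I_#|entry_index| -> B) i j k l :
  let M b m := \matrix_(r, c) x (enum_rank (b, m, r, c) : 'I_#|entry_index|) in
  mmap f x (cross_poly i j k l) = \tr (M false i *m M true j *m M false k *m M true l).
Proof.
move=> M; rewrite /cross_poly -trace_map_mx !map_mxM.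
have ME b m : map_mx (mmap f x) (entry_poly b m) = M b m.
  by apply/matrixP => r c; rewrite !mxE mmapX mmap1U.
by rewrite !ME.
Qed.

Lemma cross_poly_eval i j k l x : cross_fun i j k l x = (cross_poly i j k l).@[entries x].
Proof.
rewrite /meval mmap_cross_poly /cross_fun; congr (\tr (_ *m _ *m _ *m _));
  by apply/matrixP => r c; rewrite mxE enum_rankK.
Qed.

Lemma cross_inv i j k l : cross_fun i j k l \in @inv_regular F.
Proof.
apply/inv_regularP; split; first by exists (cross_poly i j k l); exact: cross_poly_eval.
move=> g x y ug [fy sy]; rewrite /cross_fun !fy !sy.
rewrite !mulmxA mxtrace_mulC !mulmxA mulVmx // mul1mx.
by do 3!rewrite -(mulmxA _ (invmx g) g) mulVmx // mulmx1.
Qed.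

Definition cross i j k l : invariants F := Invariant (cross_inv i j k l).

(** The diagonal units pick single entries out of the second system; the inverse permutations undo
    the orderings. *)
Lemma generic_value_cross a j b l :
  generic_value (cross (s^-1 a)%g (t^-1 j)%g (s^-1 b)%g (t^-1 l)%g) =
  iota 6%:R^-1 ^+ 2 * (W a j * Y j b * (W b l * Y l a)).
Proof.
rewrite (generic_valueE (f := cross _ _ _ _) (cross_poly_eval _ _ _ _)) mmap_cross_poly.
set M1 := \matrix_(r, c) _; set M2 := \matrix_(r, c) _; set M3 := \matrix_(r, c) _.
set M4 := \matrix_(r, c) _.
have M1E : M1 = delta_mx a a.
  by apply/matrixP => r c; rewrite !mxE /generic_entry enum_rankK /= permKV.
have M3E : M3 = delta_mx b b.
  by apply/matrixP => r c; rewrite !mxE /generic_entry enum_rankK /= permKV.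
rewrite M1E M3E -(mulmxA (_ *m _)) /mxtrace (bigD1 a) //= big1 ?addr0 => [|k ka].
  rewrite mxE (bigD1 b) //= big1 ?addr0 => [|k kb].
    have dE (M : 'M[R]_6) r c : (delta_mx r r *m M) r c = M r c.
      rewrite mxE (bigD1 r) //= big1 ?addr0 => [|k kr]; first by rewrite mxE !eqxx mul1r.
      by rewrite mxE (negPf kr) andbF mul0r.
    rewrite !dE !mxE /generic_entry !enum_rankK /= !permKV; ring.
  rewrite [X in _ * X]mxE big1 ?mulr0 // => m _; by rewrite mxE (negPf kb) mul0r.
rewrite mxE big1 // => m _; rewrite mxE big1 ?mul0r // => n _.
by rewrite mxE (negPf ka) mul0r.
Qed.
End GenericIdeal.

(** * The lower bound for the dimension *)

Section Jacobian.
Variables (F : fieldType) (R : idomainType) (iota : {rmorphism F -> R}).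
Hypothesis charF : [pchar F] =i pred0.
Variables (n : nat) (r : 'I_n -> R).
Local Notation ev := (mmap iota r).

Lemma mpoly_rect (P : {mpoly F[n]} -> Prop) : (forall c, P c%:MP) -> (forall i, P 'X_i) ->
  (forall p q, P p -> P q -> P (p + q)) -> (forall p q, P p -> P q -> P (p * q)) ->
  forall p, P p.
Proof.
move=> PC PX PD PM p; rewrite [p]mpolyE; elim/big_ind: _ => //.
  by rewrite -(mpolyC0 n F).
move=> m _; rewrite -mul_mpolyC; apply: (PM _ _ (PC _)); rewrite mpolyXE_id.
elim/big_ind: _ => // [|i _]; first exact: PC.
elim: (m i) => [|k IH]; first exact: PC.
by rewrite exprS; apply: PM.
Qed.

Lemma chain_rule (D : R -> R) (p : {mpoly F[n]}) : derivation D -> (forall c, D (iota c) = 0) ->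
  D (ev p) = \sum_i ev p^`M(i) * D (r i).
Proof.
move=> dD D0; elim/mpoly_rect: p => [c|j|p q IHp IHq|p q IHp IHq].
- by rewrite mmapC D0 big1 // => i _; rewrite mderivC rmorph0 mul0r.
- rewrite mmapX mmap1U (bigD1 j) //= big1 => [|i ij].
    by rewrite mderivX mnm1E eqxx scale1r -[X in (X - _)%MM]add0m addmK mpolyX0 rmorph1 mul1r addr0.
  by rewrite mderivX mnm1E eq_sym (negPf ij) scale0r rmorph0 mul0r.
- rewrite rmorphD (derD dD) IHp IHq -big_split; apply: eq_bigr => i _.
  by rewrite mderivD rmorphD mulrDl.
rewrite rmorphM (derM dD) IHp IHq mulr_suml mulr_sumr -big_split; apply: eq_bigr => i _.
by rewrite mderivM rmorphD !rmorphM /=; ring.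
Qed.

(** Differentiating a relation along the [D a] and inverting the Jacobian, one finds that its
    partial derivatives are relations of smaller degree, hence 0 by induction; in characteristic
    zero the relation is then constant. *)
Lemma jacobian_indep (D : 'I_n -> R -> R) :
  (forall a, derivation (D a) /\ forall c, D a (iota c) = 0) ->
  \det (\matrix_(a, i) D a (r i)) != 0 -> forall p, ev p = 0 -> p = 0.
Proof.
move=> dD J0.
suff H k p : (forall m, p@_m != 0 -> (mdeg m < k)%N) -> ev p = 0 -> p = 0.
  by move=> p; apply: (H (msize p)) => m; rewrite -mcoeff_msupp; exact: msize_mdeg_lt.
elim: k p => [|k IH] p pk p0.
  by apply/mpolyP => m; rewrite mcoeff0; apply/eqP/negPn/negP => /pk.
have d0 i : p^`M(i) = 0.
  apply: IH => [m|].
    rewrite mcoeff_deriv => mi; have := pk (m + U_(i))%MM.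
    rewrite mdegD mdeg1 addn1 ltnS; apply.
    by apply: contraNneq mi => ->; rewrite mul0rn.
  pose v : 'rV[R]_n := \row_i ev p^`M(i).
  have vJ : v *m (\matrix_(a, i) D a (r i))^T = 0.
    apply/matrixP => a b; have [db b0] := dD b; have := chain_rule p db b0.
    rewrite p0 (der0 db) => e; rewrite mxE [RHS]mxE [RHS]e.
    by apply: eq_bigr => l _; rewrite !mxE.
  (* Over the domain [R], the adjugate does the work of the inverse. *)
  have := congr1 (fun M => M *m \adj ((\matrix_(a, i) D a (r i))^T)) vJ.
  rewrite mul0mx -mulmxA mul_mx_adj mul_mx_scalar det_tr => /matrixP/(_ 0 i)/eqP.
  by rewrite !mxE mulf_eq0 (negPf J0) => /eqP.
have pC : p = (p@_0%MM)%:MP.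
  apply/mpolyP => m; rewrite mcoeffC; have [->|m0] := eqVneq m 0%MM; first by rewrite mulr1.
  rewrite mulr0.
  have [i mi] : exists i, m i != 0%N.
    apply: contrapT => no; case/eqP: m0; apply/mnmP => i; rewrite mnm0E; apply/eqP/negPn/negP => h.
    by apply: no; exists i.
  have := congr1 (fun q => q@_(m - U_(i))) (d0 i); rewrite mcoeff_deriv mcoeff0.
  rewrite submK ?lep1mP // => /eqP; rewrite -mulr_natr mulf_eq0 => /orP[/eqP //|].
  by move/pcharf0P: charF => ->.
by move: p0; rewrite pC mmapC => /eqP; rewrite fmorph_eq0 => /eqP ->; rewrite mpolyC0.
Qed.
End Jacobian.

(** * Dephasing and four test entries *)

Section Dephasing.

(** Rows and columns are rescaled so that row 0 and column 0 become 1. The entries of [Y] serve as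
    inverses, and cross ratios do not change. *)
Definition dephase (A : comNzRingType) (W Y : 'M[A]_6) : 'M[A]_6 :=
  \matrix_(i, j) (W i j * W 0 0 * Y j 0 * Y 0 i).
Definition dephaseV (A : comNzRingType) (W Y : 'M[A]_6) : 'M[A]_6 :=
  \matrix_(j, i) (Y j i * Y 0 0 * W 0 j * W i 0).

Lemma dephase_typeII (A : comNzRingType) (W Y : 'M[A]_6) :
  typeII W Y -> typeII (dephase W Y) (dephaseV W Y).
Proof.
case=> d WY YW; have d' j i : Y j i * W i j = 1 by rewrite mulrC.
split=> [i j||].
- rewrite !mxE; transitivity ((W i j * Y j i) * (W 0 0 * Y 0 0) * (W 0 j * Y j 0) * (W i 0 * Y 0 i)).
    by ring.
  by rewrite !d !mulr1.
- apply/matrixP => i k; rewrite mxE.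
  transitivity ((Y 0 i * W k 0) * (W *m Y) i k); last first.
    rewrite WY !mxE; case: eqP => [->|_]; last by rewrite mulr0.
    by rewrite d' mul1r.
  rewrite mxE mulr_sumr; apply: eq_bigr => j _; rewrite !mxE.
  transitivity ((W 0 0 * Y 0 0) * (W 0 j * Y j 0) * (Y 0 i * W k 0 * (W i j * Y j k))); first ring.
  by rewrite !d !mul1r.
apply/matrixP => j l; rewrite mxE.
transitivity ((W 0 j * Y l 0) * (Y *m W) j l); last first.
  rewrite YW !mxE; case: eqP => [->|_]; last by rewrite mulr0.
  by rewrite d mul1r.
rewrite mxE mulr_sumr; apply: eq_bigr => i _; rewrite !mxE.
transitivity ((W 0 0 * Y 0 0) * (W i 0 * Y 0 i) * (W 0 j * Y l 0 * (Y j i * W i l))); first ring.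
by rewrite !d !mul1r.
Qed.

Lemma dephase_row0 (A : comNzRingType) (W Y : 'M[A]_6) j : typeII W Y -> dephase W Y 0 j = 1.
Proof.
case=> d _ _; rewrite mxE; transitivity ((W 0 j * Y j 0) * (W 0 0 * Y 0 0)); first ring.
by rewrite !d mulr1.
Qed.

Lemma dephase_col0 (A : comNzRingType) (W Y : 'M[A]_6) i : typeII W Y -> dephase W Y i 0 = 1.
Proof.
case=> d _ _; rewrite mxE; transitivity ((W i 0 * Y 0 i) * (W 0 0 * Y 0 0)); first ring.
by rewrite !d mulr1.
Qed.

(** Logarithmic derivatives add up over the four factors, and those of the entries of [Y] are
    opposite to those of [W]. *)
Lemma der_dephase (A : idomainType) (D : A -> A) (W Y : 'M[A]_6) i j : derivation D ->
  typeII W Y -> D (dephase W Y i j) = dephase W Y i j *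
    (Y j i * D (W i j) + Y 0 0 * D (W 0 0) - Y j 0 * D (W 0 j) - Y 0 i * D (W i 0)).
Proof.
move=> dD [d _ _]; rewrite !mxE !(derM dD).
have dY k l : D (Y k l) = - (Y k l * Y k l * D (W l k)).
  have := congr1 D (d l k); rewrite (derM dD) (der1 dD) => /eqP.
  rewrite addrC addr_eq0 => /eqP e.
  transitivity ((W l k * Y k l) * D (Y k l)); first by rewrite d mul1r.
  transitivity (Y k l * (W l k * D (Y k l))); first ring.
  rewrite e; ring.
rewrite !dY.
have := d 0 0; have := d i j.
move: (D (W i j)) (D (W 0 0)) (D (W 0 j)) (D (W i 0)) => a b e f;
  move: (W i j) (Y j i) (W 0 0) (Y 0 0) => w y w0 y0 h h0.
transitivity (w * y * (a * w0 * Y j 0 * Y 0 i) + w0 * y0 * (w * b * Y j 0 * Y 0 i)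
  - w * w0 * Y j 0 * Y 0 i * (Y j 0 * e + Y 0 i * f)); last ring.
rewrite h h0; ring.
Qed.

(** Four positions at which the four dephased motions are linearly independent. *)
Definition test_entry (b : nat) : nat * nat := nth (1, 2)%N [:: (1, 2); (1, 4); (2, 1); (4, 1)]%N b.
Definition test_row (b : 'I_4) : 'I_6 := inord (test_entry b).1.
Definition test_col (b : 'I_4) : 'I_6 := inord (test_entry b).2.

Lemma test_rowE b : test_row b = (test_entry b).1 :> nat.
Proof. by rewrite inordK //; move: b => [[|[|[|[|//]]]] ?]. Qed.
Lemma test_colE b : test_col b = (test_entry b).2 :> nat.
Proof. by rewrite inordK //; move: b => [[|[|[|[|//]]]] ?]. Qed.

Lemma det_block2 (A : comNzRingType) (M : 'M[A]_(2 + 2)) : ursubmx M = 0 -> \det M =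
  (M (lshift 2 0) (lshift 2 0) * M (lshift 2 1) (lshift 2 1) -
   M (lshift 2 0) (lshift 2 1) * M (lshift 2 1) (lshift 2 0)) *
  (M (rshift 2 0) (rshift 2 0) * M (rshift 2 1) (rshift 2 1) -
   M (rshift 2 0) (rshift 2 1) * M (rshift 2 1) (rshift 2 0)).
Proof.
have d2 (N : 'M[A]_2) : \det N = N 0 0 * N 1 1 - N 0 1 * N 1 0.
  rewrite (expand_det_row _ 0) !big_ord_recl big_ord0 /cofactor !det_mx11 !mxE /=.
  have e1 : lift ord0 ord0 = 1 :> 'I_2 by apply/val_inj.
  have e2 : lift 0 0 = 1 :> 'I_2 by apply/val_inj.
  have e3 : lift ord0 0 = 1 :> 'I_2 by apply/val_inj.
  have e4 : lift 1 0 = 0 :> 'I_2 by apply/val_inj.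
  rewrite ?(e1, e2, e3) ?e4 /bump /= expr0 expr1; ring.
by move=> u0; rewrite -{1}[M]submxK u0 det_lblock !d2 !mxE.
Qed.

Lemma dephased_deformation (F : fieldType) (z : F) : [pchar F] =i pred0 -> z ^+ 2 = z - 1 ->
  exists (R : idomainType) (iota : {rmorphism F -> R}) (eps : {rmorphism R -> F})
    (W Y : 'M[R]_6),
  [/\ cancel iota eps, typeII W Y, map_mx eps W = fourier z /\ map_mx eps Y = fourierV z,
      (forall i, W i 0 = 1) /\ (forall j, W 0 j = 1) &
      forall p, mmap iota (fun b => W (test_row b) (test_col b)) p = 0 -> p = 0].
Proof.
move=> charF z2.
have [R [iota [eps [D [W [Y [ie dD WY [eW eY] dW]]]]]]] := fourier_deformation charF z2.
have [dz _ _] := fourier_typeII z2.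
have f0 j : fourier z 0 j = 1 by rewrite mxE mul0n expr0.
have f0' i : fourier z i 0 = 1 by rewrite mxE muln0 expr0.
have v0 j : fourierV z 0 j = 1 by rewrite mxE !muln0 expr0.
have v0' i : fourierV z i 0 = 1 by rewrite mxE mul0n muln0 expr0.
have eWE i j : eps (W i j) = fourier z i j by rewrite -eW mxE.
have eYE i j : eps (Y i j) = fourierV z i j by rewrite -eY mxE.
exists R, iota, eps, (dephase W Y), (dephaseV W Y); split=> //.
- exact: dephase_typeII.
- split; apply/matrixP => i j; rewrite [LHS]mxE [X in eps X]mxE !rmorphM /= !eWE !eYE.
    by rewrite f0 v0 v0' !mulr1.
  by rewrite f0 f0' v0 !mulr1.
- by split=> i; rewrite ?dephase_row0 ?dephase_col0.
have z0 : z != 0.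
  by apply: contra_eq_neq z2 => ->; rewrite expr0n sub0r eq_sym oppr_eq0 oner_neq0.
apply: (jacobian_indep charF dD).
set J := \matrix_(a, i) _.
(* The dephased logarithmic velocity of the motion [a] at the test entry [b], that is, the Jacobian
   up to a power of [z] in each column. *)
pose N a b := let: (i, j) := test_entry b in
  log_field a i j + log_field a 0 0 - log_field a 0 j - log_field a i 0.
have JE (a b : 'I_4) : eps (J a b) = z ^+ ((test_entry b).1 * (test_entry b).2) * (N a b)%:~R.
  rewrite mxE (der_dephase _ _ (dD a).1 WY) mxE.
  rewrite !(rmorphM, rmorphD, rmorphB, rmorphN) /= !eWE !eYE !dW f0 v0 v0'.
  have dz' i j k : fourierV z j i * (z ^+ (i * j) * k) = k.
    have := dz i j; rewrite [fourier _ _ _]mxE mulrC => e.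
    by rewrite mulrA e mul1r.
  rewrite !dz' [fourier _ _ _]mxE test_rowE test_colE !mulr1 /N.
  by case: (test_entry b) => i j /=; rewrite !rmorphB rmorphD mul0n muln0 expr0 !mul1r.
apply/eqP => J0; have := congr1 eps J0; rewrite rmorph0 -det_map_mx.
have -> : map_mx eps J = \matrix_(a, b) (z ^+ ((test_entry b).1 * (test_entry b).2) * (N a b)%:~R).
  by apply/matrixP => a b; rewrite [RHS]mxE -JE [LHS]mxE.
(* The first two motions fix the last two test entries to first order, so the Jacobian is block
   triangular; the two integer diagonal blocks have determinant -108. *)
rewrite (@det_block2 _ (\matrix_(a < 4, b < 4) _)); last first.
  apply/matrixP => a b; rewrite !mxE.
  have -> : N (lshift 2 a) (rshift 2 b) = 0.
    by move: a b => [[|[|//]] ?] [[|[|//]] ?]; vm_compute.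
  by rewrite mulr0.
have [n1 n2 n3 n4] : [/\ N 0%N 0%N = 12, N 0%N 1%N = 6, N 1%N 0%N = 6 & N 1%N 1%N = -6].
  by split; vm_compute.
have [n5 n6 n7 n8] : [/\ N 2%N 2%N = -12, N 2%N 3%N = -6, N 3%N 2%N = -6 & N 3%N 3%N = 6].
  by split; vm_compute.
rewrite !mxE /= n1 n2 n3 n4 n5 n6 n7 n8.
have e1 (x y : F) : x * 12%:~R * (y * (-6)%:~R) - y * 6%:~R * (x * 6%:~R) = - (x * y * 108%:R).
  ring.
have e2 (x y : F) : x * (-12)%:~R * (y * 6%:~R) - y * (-6)%:~R * (x * (-6)%:~R) = - (x * y * 108%:R).
  ring.
have zk k : z ^+ k != 0 by exact: expf_neq0.
have c0 : 108%:R != 0 :> F by move/pcharf0P: charF => ->.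
by rewrite e1 e2 mulrNN; apply/eqP; do 2!(apply: mulf_neq0 => //); apply: mulf_neq0.
Qed.

End Dephasing.

(** * The upper bound for the dimension *)

Section RelativeDerivations.
Variables (L : fieldType).

(* L-valued derivations along [ev] that factor through the image of [ev]. *)
Definition ev_derivation (A : idomainType) (ev : {rmorphism A -> L}) (delta : A -> L) :=
  [/\ forall p q, delta (p + q) = delta p + delta q,
      forall p q, delta (p * q) = delta p * ev q + ev p * delta q &
      forall p, ev p = 0 -> delta p = 0].

Section Step.
Variables (A : idomainType) (ev : {rmorphism A -> L}) (w : L) (delta : A -> L).
Hypothesis charL : [pchar L] =i pred0.
Hypothesis dP : ev_derivation ev delta.
Let evw (p : {poly A}) : L := (map_poly ev p).[w].

Let delta0 : delta 0 = 0. Proof. by case: dP => _ _; apply; rewrite rmorph0. Qed.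

(** The extension of [delta] to polynomials that sends ['X] to [v], evaluated at [w]. *)
Definition poly_der (v : L) (p : {poly A}) : L :=
  \sum_(i < size p) delta p`_i * w ^+ i + (map_poly ev p)^`().[w] * v.

Lemma poly_der_wide v (p : {poly A}) n : (size p <= n)%N ->
  poly_der v p = \sum_(i < n) delta p`_i * w ^+ i + (map_poly ev p)^`().[w] * v.
Proof.
move=> pn; congr (_ + _); rewrite (big_ord_widen n (fun i => delta p`_i * w ^+ i)) // big_mkcond.
apply: eq_bigr => i _; case: ltnP => // h; by rewrite nth_default // delta0 mul0r.
Qed.

Lemma poly_derD v p q : poly_der v (p + q) = poly_der v p + poly_der v q.
Proof.
pose n := maxn (size p) (size q).
rewrite !(@poly_der_wide _ _ n) ?leq_maxl ?leq_maxr //; last exact: size_polyD.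
rewrite rmorphD derivD hornerD mulrDl addrACA -big_split; congr (_ + _).
by apply: eq_bigr => i _; rewrite coefD; case: dP => -> _ _; rewrite mulrDl.
Qed.

Lemma poly_derC v c : poly_der v c%:P = delta c.
Proof.
rewrite (@poly_der_wide _ _ 1) ?size_polyC_leq1 // big_ord1 coefC mulr1.
by rewrite map_polyC derivC horner0 mul0r addr0.
Qed.

Lemma poly_derCM v c p : poly_der v (c%:P * p) = delta c * evw p + ev c * poly_der v p.
Proof.
rewrite !(@poly_der_wide _ _ (size p)) //; last by rewrite mul_polyC size_scale_leq.
have -> : evw p = \sum_(i < size p) ev p`_i * w ^+ i.
  rewrite /evw (@horner_coef_wide _ (size p)) ?size_poly //.
  by apply: eq_bigr => i _; rewrite coef_map.
rewrite rmorphM /= map_polyC derivM derivC mul0r add0r hornerM hornerC.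
rewrite mulrDr addrA mulr_sumr mulr_sumr -big_split mulrA; congr (_ + _).
apply: eq_bigr => i _; rewrite coefCM; case: dP => _ -> _ /=; ring.
Qed.

Lemma poly_derXM v p : poly_der v ('X * p) = v * evw p + w * poly_der v p.
Proof.
rewrite (@poly_der_wide _ _ (size p).+1); last first.
  by have [->|p0] := eqVneq p 0; rewrite ?mulr0 ?size_poly0 // mulrC size_mulX.
rewrite big_ord_recl coefXM /= delta0 mul0r add0r /poly_der.
rewrite rmorphM /= map_polyX derivM derivX mul1r hornerD hornerM hornerX -/(evw p).
rewrite mulrDr mulr_sumr; under eq_bigr => i _ do rewrite coefXM /= exprS mulrCA.
ring.
Qed.

Lemma poly_derM v p q : poly_der v (p * q) = poly_der v p * evw q + evw p * poly_der v q.
Proof.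
have pz : poly_der v 0 = 0.
  by rewrite /poly_der size_poly0 big_ord0 rmorph0 deriv0 horner0 mul0r addr0.
elim/poly_ind: p => [|p c IH].
  by rewrite mul0r pz /evw rmorph0 horner0 !mul0r addr0.
have eX r : evw (r * 'X) = evw r * w by rewrite /evw rmorphM /= map_polyX hornerMX.
have eD r r' : evw (r + r') = evw r + evw r' by rewrite /evw rmorphD hornerD.
have eC : evw c%:P = ev c by rewrite /evw map_polyC hornerC.
have eM : evw (p * q) = evw p * evw q by rewrite /evw rmorphM hornerM.
rewrite mulrDl !poly_derD poly_derCM poly_derC mulrAC mulrC poly_derXM IH.
by rewrite [p * 'X]mulrC poly_derXM eD mulrC eX eC eM; ring.
Qed.

(** For a transcendental [w] any [v] would do. For an algebraic one, [v] is obtained by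
    differentiating the minimal polynomial, whose derivative at [w] is nonzero by minimality and
    characteristic zero. *)
Lemma ev_derivation_extend : exists v, forall p, evw p = 0 -> poly_der v p = 0.
Proof.
have kill p v : map_poly ev p = 0 -> poly_der v p = 0.
  move=> p0; rewrite /poly_der p0 deriv0 horner0 mul0r addr0 big1 // => i _.
  case: dP => _ _ ->; rewrite ?mul0r //.
  by rewrite -coef_map p0 coef0.
have [alg|trans] := pselect (exists2 p, evw p = 0 & map_poly ev p != 0); last first.
  exists 0 => p p0; apply: kill; apply: contrapT => /eqP pn0; apply: trans; by exists p.
have [m [mK m0] mmin] := image_min alg.
have m1 : (1 < size (map_poly ev m))%N.
  by apply: (@root_size_gt1 _ w) => //; exact/rootP.
have dm : (map_poly ev m)^`().[w] != 0.
  have dmE : map_poly ev m^`() = (map_poly ev m)^`() by rewrite deriv_map.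
  apply/eqP => dm; have /mmin : evw m^`() = 0 by rewrite /evw dmE.
  rewrite dmE.
  have d0 : (map_poly ev m)^`() != 0.
    apply/eqP => /polyP/(_ (size (map_poly ev m)).-2) /eqP.
    rewrite coef_deriv coef0 -mulr_natr mulf_eq0.
    move/pcharf0P: charL => ->; rewrite orbF prednK; last by case: size m1 => [|[]].
    by rewrite -lead_coefE lead_coef_eq0 (negPf m0).
  by move=> /(_ d0); rewrite leqNgt lt_size_deriv.
pose c := cut ev m.
pose v0 := poly_der 0 c.
exists (- (v0 / (map_poly ev m)^`().[w])) => p pK; set v := - _.
have dc : poly_der v c = 0.
  have : poly_der v c = v0 + (map_poly ev c)^`().[w] * v by rewrite /v0 /poly_der mulr0 addr0.
  by rewrite map_cut => ->; rewrite /v mulrN mulrCA divff // mulr1 subrr.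
have := map_divp_cut p m0; set k := scalp _ _ => /=; case=> e lt.
have r0 : map_poly ev (p %% c) = 0.
  apply: contraTeq lt => r0; rewrite -leqNgt; apply: mmin => //.
  have := congr1 (fun p => p.[w]) e.
  by rewrite hornerZ hornerD hornerM -/(evw m) -/(evw p) mK pK !mulr0 add0r.
have cK : evw c = 0 by rewrite /evw map_cut.
have := congr1 (poly_der v) (Pdiv.Idomain.divp_eq p c).
rewrite -mul_polyC poly_derCM pK mulr0 add0r poly_derD poly_derM cK dc !mulr0 !add0r.
rewrite (kill _ _ r0) => /eqP; rewrite mulf_eq0 rmorphXn expf_eq0.
by rewrite (negPf (cut_lead m0)) andbF => /eqP.
Qed.
End Step.

(** The ring [A] is the same for all [delta0], so that several extensions can be combined
    linearly. *)
Lemma ev_derivation_tower (A0 : idomainType) (ev0 : {rmorphism A0 -> L}) (w : nat -> L) n :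
  [pchar L] =i pred0 ->
  exists (A : idomainType) (j : {rmorphism A0 -> A}) (ev : {rmorphism A -> L}) (x : nat -> A),
  [/\ forall p, ev (j p) = ev0 p, forall i, (i < n)%N -> ev (x i) = w i &
     forall delta0, ev_derivation ev0 delta0 -> exists2 delta, ev_derivation ev delta &
       forall p, delta (j p) = delta0 p].
Proof.
move=> charL; elim: n => [|n [A [j [ev [x [evj evx ext]]]]]].
  by exists A0, idfun, ev0, (fun=> 0); split=> // d dP; exists d.
pose j' : {rmorphism A0 -> {poly A}} := @polyC A \o j.
pose ev' : {rmorphism {poly A} -> L} := horner_eval (w n) \o map_poly ev.
exists {poly A}, j', ev', (fun i => if i == n then 'X else (x i)%:P); split.
- by move=> c; rewrite /ev' /= map_polyC /= /horner_eval hornerC.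
- move=> i; rewrite ltnS leq_eqVlt /ev' /= /horner_eval.
  case: eqP => [-> _|_ /= /evx <-]; first by rewrite map_polyX hornerX.
  by rewrite map_polyC hornerC.
move=> d0 /ext [d dP dj]; have [v vP] := ev_derivation_extend (w n) charL dP.
exists (poly_der ev (w n) d v); last by move=> p; rewrite /j' /= poly_derC.
split=> [p q|p q|p]; [exact: poly_derD | exact: poly_derM | exact: vP].
Qed.
End RelativeDerivations.

Section SpecializedInjectivity.
Variables (F L : fieldType) (R : idomainType).
Variables (iota : {rmorphism F -> R}) (eps : {rmorphism R -> F}) (h : {rmorphism R -> L}).
Hypothesis epsK : cancel iota eps.
Hypothesis h0 : forall r, h r = 0 -> r = 0.

(* A left inverse over F of the specialized system lifts to a matrix over R with
   determinant specializing to 1. *)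
Lemma specialized_injectivity (I J : finType) (c : I -> J -> R) :
  (forall v : J -> F, (forall i, \sum_j eps (c i j) * v j = 0) -> forall j, v j = 0) ->
  forall v : J -> L, (forall i, \sum_j h (c i j) * v j = 0) -> forall j, v j = 0.
Proof.
move=> inj v vc j.
pose M := \matrix_(i < #|I|, j < #|J|) c (enum_val i) (enum_val j).
have sumE (B : comNzRingType) (f : J -> B) : \sum_j f j = \sum_(k < #|J|) f (enum_val k).
  by rewrite big_enum_val.
have full : row_full (map_mx eps M).
  rewrite /row_full -mxrank_tr -/(row_free _) -kermx_eq0; apply/eqP/row_matrixP => k.
  rewrite row0; set u := row k _.
  have uM : u *m (map_mx eps M)^T = 0.
    by apply/sub_kermxP; exact: row_sub.
  have u0 := inj (fun j => u 0 (enum_rank j)) _.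
  apply/rowP => l; rewrite -[l]enum_valK u0 ?mxE // => i.
  rewrite sumE; have := congr1 (fun N : 'rV_#|I| => N 0 (enum_rank i)) uM; rewrite !mxE => e.
  by rewrite -[RHS]e; apply: eq_bigr => m _; rewrite !mxE enum_rankK enum_valK mulrC.
have [G GM] := row_fullP full.
pose N := map_mx iota G *m M.
have N1 : map_mx eps N = 1%:M.
  rewrite map_mxM -[RHS]GM; congr (_ *m _).
  by apply/matrixP => a b; rewrite !mxE epsK.
have dN : \det (map_mx h N) != 0.
  rewrite det_map_mx; apply: contra_eq_neq (det1 F #|J|) => /h0 d0.
  by rewrite -N1 det_map_mx d0 rmorph0 eq_sym oner_neq0.
pose u : 'cV[L]_#|J| := \col_k v (enum_val k).
have Nu : map_mx h N *m u = 0.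
  rewrite map_mxM -mulmxA (_ : map_mx h M *m u = 0) ?mulmx0 //.
  apply/colP => i; rewrite !mxE -[RHS](vc (enum_val i)) sumE.
  by apply: eq_bigr => k _; rewrite !mxE.
have := congr1 (mulmx (\adj (map_mx h N))) Nu; rewrite mulmx0 mulmxA mul_adj_mx.
rewrite mul_scalar_mx => /colP/(_ (enum_rank j))/eqP.
by rewrite !mxE enum_rankK mulf_eq0 (negPf dN) => /eqP.
Qed.
End SpecializedInjectivity.

(** * The linearized equations at the Fourier matrix *)

Section LinearizedSystem.

(** At frequency [m] the linearized equations identify rows in the same coset of the subgroup of Z/6
    generated by [m]. The pairs represent the nonzero frequencies and the cosets that do not contain
    row 0. *)
Definition free_mode (i m : 'I_6) : bool :=
  (i, m) \in [:: (1, inord 2); (1, inord 3); (1, inord 4); (inord 2, inord 3)].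

(* Linearization of the dephased type II equations in logarithmic coordinates,
   together with four functionals that cut its solution space at the Fourier
   matrix down to 0. *)
Definition linearized (A : comNzRingType) (W Y : 'M[A]_6) (x : bool * 'I_6 * 'I_6)
    (p : 'I_6 * 'I_6) : A :=
  let: (b, i, m) := x in let: (a, j) := p in
  if b then W i j * Y j m * ((a == i)%:R - (a == m)%:R)
  else if i == 0 then ((a == 0) && (j == m))%:R
  else if m == 0 then ((a == i) && (j == 0))%:R
  else if free_mode i m then (a == i)%:R * W m j else 0.

Lemma map_linearized (A B : comNzRingType) (f : {rmorphism A -> B}) (W Y : 'M[A]_6) x p :
  f (linearized W Y x p) = linearized (map_mx f W) (map_mx f Y) x p.
Proof.
case: x p => [[[] i] m] [a j] /=; first by rewrite !rmorphM rmorphB !rmorph_nat !mxE.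
do 3!(case: ifP => _; rewrite ?rmorph_nat ?rmorph0 //).
by rewrite rmorphM rmorph_nat mxE.
Qed.

Section Sums.
Variables (A : comNzRingType) (W Y : 'M[A]_6) (v : 'I_6 * 'I_6 -> A).
Local Notation S x := (\sum_p linearized W Y x p * v p).

Lemma sum_pairs (f : 'I_6 * 'I_6 -> A) : \sum_p f p = \sum_a \sum_j f (a, j).
Proof. by rewrite pair_bigA; apply: eq_bigr => -[]. Qed.

Lemma pick_row (i : 'I_6) (f : 'I_6 -> 'I_6 -> A) :
  \sum_a \sum_j (a == i)%:R * f a j = \sum_j f i j.
Proof.
rewrite (bigD1 i) //= [X in _ + X]big1 ?addr0 => [|a ai].
  by apply: eq_bigr => j _; rewrite eqxx mul1r.
by rewrite big1 // => j _; rewrite (negPf ai) mul0r.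
Qed.

Lemma linearized_eqn i k :
  S (true, i, k) = \sum_j W i j * Y j k * (v (i, j) - v (k, j)).
Proof.
rewrite sum_pairs /=.
transitivity (\sum_a \sum_j (a == i)%:R * (W i j * Y j k * v (a, j)) -
  \sum_a \sum_j (a == k)%:R * (W i j * Y j k * v (a, j))).
  rewrite -sumrB; apply: eq_bigr => a _; rewrite -sumrB; apply: eq_bigr => j _; ring.
rewrite !pick_row -sumrB; apply: eq_bigr => j _; ring.
Qed.

Lemma linearized_row0 m : S (false, 0, m) = v (0, m).
Proof.
rewrite (bigD1 (0, m)) //= !eqxx mul1r big1 ?addr0 // => -[a j] /=.
by rewrite xpair_eqE => /negPf ->; rewrite mul0r.
Qed.

Lemma linearized_col0 i : S (false, i, 0) = v (i, 0).
Proof.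
have [->|i0] := eqVneq i 0; first exact: linearized_row0.
rewrite (bigD1 (i, 0)) //= (negPf i0) !eqxx mul1r big1 ?addr0 // => -[a j] /=.
by rewrite xpair_eqE => /negPf ->; rewrite mul0r.
Qed.

Lemma linearized_mode i m : i != 0 -> m != 0 ->
  S (false, i, m) = if free_mode i m then \sum_j W m j * v (i, j) else 0.
Proof.
move=> i0 m0.
rewrite sum_pairs /=.
rewrite (negPf i0) (negPf m0); case: ifP => _.
  rewrite -[RHS](pick_row i (fun a j => W m j * v (a, j))).
  by apply: eq_bigr => a _; apply: eq_bigr => j _; rewrite mulrA.
by rewrite big1 // => a _; rewrite big1 // => j _; rewrite mul0r.
Qed.
End Sums.

(** Let [h i m] be the Fourier transform of row [i] at frequency [m]. The equation for rows [i] and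
    [k] equates their transforms at frequency [i - k]. As row 0 and the free modes vanish, all
    nonzero frequencies vanish; the rows are constant, and 0 because column 0 is. *)
Lemma fourier_rigid (F : fieldType) (z : F) (v : 'I_6 * 'I_6 -> F) :
  (6%:R : F) != 0 -> z ^+ 2 = z - 1 ->
  (forall x, \sum_p linearized (fourier z) (fourierV z) x p * v p = 0) -> forall p, v p = 0.
Proof.
move=> F6 z2 S0.
have [_ _ VW] := fourier_typeII z2.
have z6 : z ^+ 6 = 1 by rewrite -(eval_epow z2) /eval_eis /= mul0r addr0.
pose h i m := \sum_j fourier z (inord m) j * v (inord i, j).
have E i k m : (i < 6)%N -> (k < 6)%N -> m = ((i + 5 * k) %% 6)%N -> h i m = h k m.
  move=> i6 k6 ->; apply/eqP; rewrite -subr_eq0 -sumrB; apply/eqP.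
  rewrite -[RHS](S0 (true, inord i, inord k)) linearized_eqn.
  apply: eq_bigr => j _; rewrite -mulrBr; congr (_ * _).
  rewrite !mxE !inordK ?ltn_mod // -exprD.
  rewrite (mulnA 5) -mulnDl exprM [in RHS]exprM; congr (_ ^+ _).
  by rewrite [in RHS](divn_eq (i + 5 * k) 6) exprD [(_ %/ _ * _)%N]mulnC exprM z6 expr1n mul1r.
have h0 m : h 0 m = 0.
  rewrite /h big1 // => j _; rewrite (_ : inord 0 = 0); last by apply/val_inj; rewrite /= inordK.
  by rewrite -(linearized_row0 (fourier z) (fourierV z) v j) S0 mulr0.
have iE (n : 'I_6) : inord n = n by apply/val_inj; rewrite /= inordK.
have i1 : inord 1 = 1 :> 'I_6 by apply/val_inj; rewrite /= inordK.
have hT i m : (0 < i < 6)%N -> (0 < m < 6)%N -> free_mode (inord i) (inord m) -> h i m = 0.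
  case/andP=> i0 i6 /andP[m0 m6] im; have := S0 (false, inord i, inord m).
  rewrite linearized_mode ?im // -val_eqE /= inordK // -lt0n //.
have hv i m : (i < 6)%N -> (0 < m < 6)%N -> h i m = 0.
  have t2 : h 1 2 = 0 by apply: hT => //; rewrite /free_mode i1 !inE eqxx.
  have t3 : h 1 3 = 0 by apply: hT => //; rewrite /free_mode i1 !inE eqxx orbT.
  have t4 : h 1 4 = 0 by apply: hT => //; rewrite /free_mode i1 !inE eqxx !orbT.
  have t5 : h 2 3 = 0 by apply: hT => //; rewrite /free_mode !inE eqxx !orbT.
  (* Each equality leads toward row 0 or toward a free mode. *)
  have step : ((h 1 1 = h 0 1) * (h 2 1 = h 1 1) * (h 3 1 = h 2 1) * (h 4 1 = h 3 1) * (h 5 1 = h 4 1) *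
    (h 2 2 = h 0 2) * (h 3 2 = h 1 2) * (h 4 2 = h 2 2) * (h 5 2 = h 3 2) * (h 3 3 = h 0 3) *
    (h 4 3 = h 1 3) * (h 5 3 = h 2 3) * (h 2 4 = h 4 4) * (h 3 4 = h 5 4) * (h 4 4 = h 0 4) *
    (h 5 4 = h 1 4) * (h 1 5 = h 2 5) * (h 2 5 = h 3 5) * (h 3 5 = h 4 5) * (h 4 5 = h 5 5) *
    (h 5 5 = h 0 5))%type.
    by do !split; apply: E.
  case: m => [|[|[|[|[|[|//]]]]]] //; case: i => [|[|[|[|[|[|//]]]]]] // _ _;
    by rewrite ?(step, h0, t2, t3, t4, t5).
(* Fourier inversion, with only the frequency 0 left. *)
have const i j : 6%:R * v (i, j) = h i 0%N.
  have := congr1 (fun M : 'M_6 => \sum_k M j k * v (i, k)) VW.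
  rewrite [RHS](bigD1 j) //= [X in _ + X]big1 ?addr0 => [|k kj]; last first.
    by rewrite mxE eq_sym (negPf kj) mulr0n mul0r.
  rewrite mxE eqxx mulr1n => <-.
  transitivity (\sum_m fourierV z j m * h i m); last first.
    rewrite big_ord_recl big1 ?addr0 => [|m _]; last by rewrite hv ?mulr0 ?ltn_ord.
    by rewrite mxE mul0n muln0 expr0 mul1r.
  under eq_bigr => k _ do rewrite mxE mulr_suml.
  rewrite exchange_big; apply: eq_bigr => m _; rewrite mulr_sumr.
  by apply: eq_bigr => k _; rewrite !iE mulrA.
move=> [i j]; have := linearized_col0 (fourier z) (fourierV z) v i; rewrite S0 => vi0.
have := const i j; rewrite -(const i 0) -vi0 mulr0 => /eqP.
by rewrite mulf_eq0 (negPf F6) => /eqP.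
Qed.
End LinearizedSystem.

(** * Dependence of any five invariants *)

Section UpperBound.
Variables (s t : 'S_6) (F : closedFieldType) (R : idomainType) (z : F).
Hypothesis charF : [pchar F] =i pred0.
Hypothesis z2 : z ^+ 2 = z - 1.
Variables (iota : {rmorphism F -> R}) (eps : {rmorphism R -> F}) (W Y : 'M[R]_6).
Hypothesis epsK : cancel iota eps.
Hypothesis WY : typeII W Y.
Hypotheses (eW : map_mx eps W = fourier z) (eY : map_mx eps Y = fourierV z).
Hypotheses (W0 : forall i, W i 0 = 1) (W1 : forall j, W 0 j = 1).
Local Notation gen := (generic_entry s t iota W Y).
Let L : fieldType := {fraction R}.
Let h : {rmorphism R -> L} := @tofrac R.

Let F6 : (6%:R : F) != 0. Proof. by move/pcharf0P: charF => ->. Qed.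
Let h0 r : h r = 0 -> r = 0. Proof. by move/eqP; rewrite tofrac_eq0 => /eqP. Qed.
Let charL : [pchar L] =i pred0.
Proof. by move=> p; rewrite (fmorph_pchar (h \o iota : {rmorphism F -> L})). Qed.

Lemma linearized_rigid (v : 'I_6 * 'I_6 -> L) :
  (forall x, \sum_p h (linearized W Y x p) * v p = 0) -> forall p, v p = 0.
Proof.
apply: (specialized_injectivity epsK h0) => v' v'0; apply: (fourier_rigid F6 z2) => x.
by rewrite -[RHS](v'0 x); apply: eq_bigr => p _; rewrite map_linearized eW eY.
Qed.

Section Derivation.
Variables (A : idomainType) (ev : {rmorphism A -> L}) (delta : A -> L).
Hypothesis dP : ev_derivation ev delta.
Variables (XW XY : 'M[A]_6).
Hypotheses (eXW : forall i j, ev (XW i j) = h (W i j))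
  (eXY : forall i j, ev (XY i j) = h (Y i j)).
Local Notation v := (fun p : 'I_6 * 'I_6 => h (Y p.2 p.1) * delta (XW p.1 p.2)).

Let dD := let: And3 d _ _ := dP in d.
Let dM := let: And3 _ d _ := dP in d.
Let dK := let: And3 _ _ d := dP in d.

Lemma evder0 : delta 0 = 0. Proof. by apply: dK; rewrite rmorph0. Qed.
Lemma evder1 : delta 1 = 0.
Proof.
have /eqP := dM 1 1; rewrite rmorph1 !mulr1 mul1r -subr_eq0 opprD addrA subrr sub0r.
by rewrite oppr_eq0 => /eqP.
Qed.
Lemma evder_eq p q : ev p = ev q -> delta p = delta q.
Proof.
move=> e; have := dK (p := p - q); rewrite rmorphB e subrr => /(_ erefl) d.
by rewrite -[p](subrK q) dD d add0r.
Qed.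
Lemma evder_nat n : delta n%:R = 0.
Proof. by elim: n => [|n IH]; rewrite ?evder0 // mulrS dD evder1 IH addr0. Qed.
Lemma evder_sum (I : Type) (r : seq I) (f : I -> A) :
  delta (\sum_(i <- r) f i) = \sum_(i <- r) delta (f i).
Proof. exact: (big_morph _ dD evder0). Qed.

Lemma der_inverse i j : delta (XY j i) = - (h (Y j i) * h (Y j i) * delta (XW i j)).
Proof.
case: WY => d _ _; have hd : h (W i j) * h (Y j i) = 1 by rewrite -rmorphM d rmorph1.
have : delta (XW i j * XY j i) = 0.
  by rewrite -evder1; apply: evder_eq; rewrite rmorphM eXW eXY hd rmorph1.
rewrite dM eXW eXY => /eqP; rewrite addrC addr_eq0 => /eqP e.
transitivity (h (W i j) * h (Y j i) * delta (XY j i)); first by rewrite hd mul1r.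
by rewrite mulrAC e; ring.
Qed.

(** The logarithmic derivatives of the entries solve the linearized system, by differentiating
    [W Y = 6] and the normalization of row 0 and column 0; [test] gives the four other equations. *)
Lemma der_rigid : (forall i m, i != 0 -> m != 0 -> free_mode i m ->
    \sum_j h (W m j) * v (i, j) = 0) ->
  (forall i j, delta (XW i j) = 0) /\ (forall i j, delta (XY i j) = 0).
Proof.
move=> test; case: (WY) => d WY6 _.
have hd i j : h (W i j) * h (Y j i) = 1 by rewrite -rmorphM d rmorph1.
suff v0 : forall p, v p = 0.
  have dW i j : delta (XW i j) = 0.
    have /= := v0 (i, j) => e; rewrite -[LHS]mul1r -(hd i j) -mulrA e mulr0 //.
  by split=> // i j; rewrite der_inverse dW mulr0 oppr0.
apply: (linearized_rigid (v := v)) => -[[b i] m].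
have dW0 k j : (k == 0) || (j == 0) -> delta (XW k j) = 0.
  move=> kj; rewrite -evder1; apply: evder_eq; rewrite eXW rmorph1.
  by case/orP: kj => /eqP ->; rewrite ?W0 ?W1 rmorph1.
under eq_bigr => p _ do rewrite map_linearized.
case: b.
  rewrite linearized_eqn.
  have : delta (\sum_j XW i j * XY j m) = 0.
    rewrite -(evder_nat (6 * (i == m))); apply: evder_eq.
    have := congr1 (fun M : 'M_6 => h (M i m)) WY6.
    rewrite !mxE rmorph_sum rmorph_nat rmorphMn rmorph_nat natrM mulr_natr => <-.
    by rewrite rmorph_sum; apply: eq_bigr => j _; rewrite !rmorphM eXW eXY.
  rewrite evder_sum => e; rewrite -[RHS]e; apply: eq_bigr => j _.
  rewrite dM eXW eXY der_inverse !mxE /=.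
  transitivity ((h (W i j) * h (Y j i)) * (h (Y j m) * delta (XW i j)) -
    h (W i j) * h (Y j m) * (h (Y j m) * delta (XW m j))); first ring.
  rewrite hd; ring.
have [->|i0] := eqVneq i 0; first by rewrite linearized_row0 dW0 ?mulr0 ?eqxx.
have [->|m0] := eqVneq m 0; first by rewrite linearized_col0 dW0 ?mulr0 ?eqxx ?orbT.
rewrite linearized_mode //; case: ifP => // im; rewrite -[RHS](test i m) //.
by apply: eq_bigr => j _; rewrite mxE.
Qed.
End Derivation.

(** Otherwise the five partial derivatives extend to derivations defined on the entries of [W] and
    [Y]. A nonzero combination kills the four free modes, hence all entries and the five values; but
    on the [i]-th value it equals its own coefficient [lam 0 i]. *)
Lemma generic_dependent (q : 'I_5 -> {mpoly F[#|entry_index|]}) :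
  ~ (forall p : {mpoly F[5]}, mmap iota (fun i => mmap iota gen (q i)) p = 0 -> p = 0).
Proof.
move=> ind; pose iL : {rmorphism F -> L} := h \o iota.
pose f i := h (mmap iota gen (q i)).
pose ev0 : {rmorphism {mpoly F[5]} -> L} := mmap iL f.
have ev0X i : ev0 'X_i = f i by rewrite /ev0 /= mmapX mmap1U.
have ev0C c : ev0 c%:MP = iL c by rewrite /ev0 /= mmapC.
have ev0K p : ev0 p = 0 -> p = 0.
  move=> p0; apply: ind; apply: h0; rewrite -[RHS]p0 rmorph_mmap.
  exact: eq_mmap.
pose V : finType := (bool * 'I_6 * 'I_6)%type.
pose wV (k : V) : L := let: (b, i, j) := k in h (if b then W i j else Y i j).
pose w i := if insub i is Some k then wV (enum_val (k : 'I_#|V|)) else 0.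
have [A [j [ev [x [evj evx ext]]]]] := ev_derivation_tower ev0 w #|V| charL.
pose XW := \matrix_(a, b) x (enum_rank ((true, a, b) : V)).
pose XY := \matrix_(a, b) x (enum_rank ((false, a, b) : V)).
have evV k : ev (x (enum_rank (k : V))) = wV k by rewrite evx // /w valK enum_rankK.
have eXW a b : ev (XW a b) = h (W a b) by rewrite mxE evV.
have eXY a b : ev (XY a b) = h (Y a b) by rewrite mxE evV.
(* Independence makes [ev0] injective, so the partial derivatives factor through its image. *)
have d0P (i : 'I_5) : ev_derivation ev0 (fun p => ev0 p^`M(i)).
  split=> [p p'|p p'|p /ev0K ->].
  - by rewrite mderivD rmorphD.
  - by rewrite mderivM rmorphD !rmorphM.
  by rewrite mderiv0 rmorph0.
have ex i : exists d, ev_derivation ev d /\ forall p, d (j p) = ev0 p^`M(i).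
  by have [d dP dj] := ext _ (d0P i); exists d.
have [D DP] := fin_all_exists ex.
pose modes : 'I_4 -> 'I_6 * 'I_6 := fun b => nth (1, inord 2)
  [:: (1, inord 2); (1, inord 3); (1, inord 4); (inord 2, inord 3)] b.
pose T : 'M[L]_(5, 4) := \matrix_(i, b)
  \sum_k h (W (modes b).2 k) * (h (Y k (modes b).1) * D i (XW (modes b).1 k)).
(* There are five derivations and only four modes. *)
have kT : kermx T != 0.
  rewrite -mxrank_eq0 mxrank_ker -lt0n subn_gt0.
  exact: leq_ltn_trans (rank_leq_col T) _.
pose lam := nz_row (kermx T).
have lam0 : lam != 0 by rewrite nz_row_eq0.
have lamT : lam *m T = 0 by apply/sub_kermxP; exact: nz_row_sub.
pose delta a := \sum_i lam 0 i * D i a.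
have dP : ev_derivation ev delta.
  split=> [p p'|p p'|p p0].
  - rewrite -big_split; apply: eq_bigr => i _; have [[-> _ _] _] := DP i; exact: mulrDr.
  - rewrite mulr_suml mulr_sumr -big_split; apply: eq_bigr => i _.
    have [[_ -> _] _] := DP i; rewrite /=; ring.
  by rewrite /delta big1 // => i _; have [[_ _ DK] _] := DP i; rewrite (DK _ p0) mulr0.
have [|dW dY] := der_rigid dP eXW eXY.
  move=> i m i0 m0 im; have [b [bi bm]] : exists b, (modes b).1 = i /\ (modes b).2 = m.
    move: im; rewrite /free_mode !inE => /or4P[] /eqP[-> ->];
    [exists (inord 0)|exists (inord 1)|exists (inord 2)|exists (inord 3)];
    by rewrite /modes inordK.
  have := congr1 (fun M : 'M_(1, 4) => M 0 b) lamT; rewrite !mxE => e.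
  rewrite -[RHS]e /delta; under [RHS]eq_bigr => l _ do rewrite mxE mulr_sumr.
  rewrite exchange_big; apply: eq_bigr => k _; rewrite bi bm /= !mulr_sumr.
  apply: eq_bigr => l _; ring.
have dj p : delta (j p) = \sum_i lam 0 i * ev0 p^`M(i).
  by apply: eq_bigr => i _; have [_ ->] := DP i.
have dC (c : F) : delta (j c%:MP) = 0.
  by rewrite dj big1 // => i _; rewrite mderivC rmorph0 mulr0.
pose e k := sys_entry s t (j (6%:R^-1)%:MP) XW XY (enum_val (k : 'I_#|entry_index|)).
have [dD dM dK] := dP.
have de k : delta (e k) = 0.
  rewrite /e; case: (enum_val k) => [[[[] i] r] c] /=; last exact: evder_nat dP _.
  by rewrite !dM dW dY dC !(mulr0, mul0r, addr0).
pose jC : {rmorphism F -> A} := j \o @mpolyC 5 F.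
have dQ p : delta (mmap jC e p) = 0.
  elim/mpoly_rect: p => [c|k|p p' IH IH'|p p' IH IH'].
  - by rewrite mmapC /jC /= dC.
  - by rewrite mmapX mmap1U de.
  - by rewrite rmorphD dD IH IH' addr0.
  by rewrite rmorphM dM IH IH' mulr0 mul0r addr0.
(* The [i]-th value has two lifts to [A], one through the entries and one through the variable
   ['X_i]; [delta] agrees on them. *)
have evQ i : ev (mmap jC e (q i)) = ev (j 'X_i).
  rewrite evj ev0X /f !rmorph_mmap; apply: eq_mmap => [c|k].
    by rewrite /jC /= evj ev0C.
  rewrite /e /= map_sys_entry evj ev0C /generic_entry map_sys_entry.
  by congr sys_entry; apply/matrixP => a b; rewrite !mxE ?eXW -?eXW -?eXY !mxE.
case/eqP: lam0; apply/rowP => i; rewrite mxE -[RHS](dQ (q i)) (evder_eq dP (evQ i)).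
rewrite dj (bigD1 i) //= big1 ?addr0 => [|k ki].
  by rewrite mderivX mnm1E eqxx scale1r -[X in (X - _)%MM]add0m addmK mpolyX0 rmorph1 mulr1.
by rewrite mderivX mnm1E eq_sym (negPf ki) scale0r rmorph0 mulr0.
Qed.
End UpperBound.

(** * The standard pair *)

Section StandardPair.

Section Selection.
Variables (F : fieldType) (n : nat) (P : 'I_n -> 'M[F]_n).
Hypotheses (PP : forall i, P i *m P i = P i) (rP : forall i, \rank (P i) = 1%N).
Hypothesis oP : forall i j, i != j -> P i *m P j = 0.

(** [M] is a combination of the [P i]. A nonzero coefficient is 1 by idempotency, and equality of
    ranks then forces [M] to be that projector. *)
Lemma span_idempotent (M : 'M[F]_n) : M \in (<<[seq P i | i : 'I_n]>> + <[1%:M]>)%VS ->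
  M *m M = M -> \rank M = 1%N -> exists i, M = P i.
Proof.
move=> /memv_addP[h /system_span[a hE] [_ /vlineP[c ->] ME]] MM rM.
pose b i := a i + c.
have MbE : M = \sum_i b i *: P i.
  rewrite ME hE -(system_sum PP rP oP) scaler_sumr -big_split.
  by apply: eq_bigr => i _; rewrite scalerDl.
have Mb i : M *m P i = b i *: P i /\ P i *m M = b i *: P i.
  by rewrite MbE; exact: system_sumM.
have [i bi] : exists i, b i != 0.
  apply: contrapT => no; have : \rank M = 0%N; last by rewrite rM.
  apply/eqP; rewrite mxrank_eq0 MbE big1 // => i _.
  by have [->|bi] := eqVneq (b i) 0; [rewrite scale0r | case: no; exists i].
have [MPi PiM] := Mb i; exists i.
have Pi0 : P i != 0 by rewrite -mxrank_eq0 rP.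
have b1 : b i = 1.
  have : b i *: P i = (b i * b i) *: P i.
    by rewrite -scalerA -MPi scalemxAr -MPi mulmxA MM.
  move/eqP; rewrite -subr_eq0 -scalerBl scaler_eq0 (negPf Pi0) orbF.
  rewrite -{1}[b i]mulr1 -mulrBr mulf_eq0 (negPf bi) subr_eq0 => /eqP //.
rewrite b1 scale1r in MPi PiM.
have sub : (P i <= M)%MS by rewrite -PiM submxMl.
have := mxrank_leqif_sup sub; rewrite rM rP => /leqif_refl.
by move=> /submxP[X MX]; rewrite -MPi [in RHS]MX -mulmxA PP.
Qed.
End Selection.

Lemma system_injective (F : fieldType) n m (Q : 'I_m -> 'M[F]_n) :
  (forall i, Q i *m Q i = Q i) -> (forall i, \rank (Q i) = 1%N) ->
  (forall i j, i != j -> Q i *m Q j = 0) -> injective Q.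
Proof.
move=> QQ rQ oQ i j e; apply/eqP; apply: contraT => /oQ; rewrite -e QQ => Q0.
by have := rQ i; rewrite Q0 mxrank0.
Qed.

Section Fourier.
Variables (F : fieldType) (z : F).
Hypothesis F6 : (6%:R : F) != 0.
Hypothesis z2 : z ^+ 2 = z - 1.
Local Notation W := (fourier z).
Local Notation Y := (fourierV z).
Let WY := fourier_typeII z2.
Local Notation Q := (col_proj 1 W Y).

(** The columns of the Fourier matrix are eigenvectors of the cyclic shift; [5 * l] stands for [- l]
    modulo 6. *)
Lemma cycle_op_col_proj l : cycle_op F *m Q l = z ^+ (5 * l) *: Q l.
Proof.
have z6 : z ^+ 6 = 1 by rewrite -(eval_epow z2) /eval_eis /= mul0r addr0.
apply/matrixP => i j; rewrite mxE (bigD1 (ord_pred i)) //= big1 ?addr0.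
  rewrite mxE ord_predK eqxx mul1r [RHS]mxE !col_projE !perm1 [RHS]mulrCA; congr (_ * _).
  rewrite !mxE [RHS]mulrA; congr (_ * _); rewrite -exprD.
  have -> : (5 * l + i * l = (i + 5) * l)%N by rewrite mulnDl addnC.
  rewrite exprM [in RHS]exprM; congr (_ ^+ _).
  have -> : ord_pred i = ((i + 5) %% 6)%N :> nat by rewrite /= addnS.
  by rewrite [in RHS](divn_eq (i + 5) 6) exprD [(_ %/ _ * _)%N]mulnC exprM z6 expr1n mul1r.
move=> k ki; rewrite mxE; case: eqP => [e|_]; last by rewrite mul0r.
by case/eqP: ki; rewrite e ordSK.
Qed.

Let QQ i : Q i *m Q i = Q i. Proof. by rewrite (col_projM 1 F6 WY) eqxx. Qed.
Let rQ i : \rank (Q i) = 1%N. Proof. exact: (col_proj_rank 1 F6 WY). Qed.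
Let oQ i j : i != j -> Q i *m Q j = 0.
Proof. by move=> /negPf ij; rewrite (col_projM 1 F6 WY) ij. Qed.

Lemma cycle_cartan_sub : (cycle_cartan F <= <<[seq Q l | l : 'I_6]>>)%VS.
Proof.
apply/span_subvP => _ /mapP[k _ ->].
have -> : (cycle_op F ^+ k)%R = \sum_(l < 6) (z ^+ (5 * l)) ^+ k *: Q l.
  elim: k => [|k IH].
    by rewrite -[LHS](system_sum QQ rQ oQ); apply: eq_bigr => l _; rewrite expr0 scale1r.
  rewrite exprS IH -[LHS]/(cycle_op F *m _) mulmx_sumr; apply: eq_bigr => l _.
  by rewrite -scalemxAr cycle_op_col_proj scalerA -exprSr.
by apply: rpred_sum => l _; apply/rpredZ/memv_span/map_f; rewrite mem_enum.
Qed.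

(** By [span_idempotent] every projector of the pair is a diagonal unit or a Fourier projector;
    since the projectors of a system are distinct, the index maps are permutations. *)
Lemma standard_coordinates (x : opair F) : represents x (diag_cartan F) (cycle_cartan F) ->
  exists s t : 'S_6, forall k, entry x k = sys_entry s t 6%:R^-1 W Y k.
Proof.
case=> fx sx.
have exf i : exists k, fst_sys x i = delta_mx k k.
  apply: (@span_idempotent F 6 (fun i => delta_mx i i)).
  - by move=> l; rewrite mul_delta_mx.
  - by move=> l; rewrite mxrank_delta.
  - by move=> l l' ll; rewrite mul_delta_mx_0.
  - by apply: subvP (fx i); apply: addvS => //; exact: capvSl.
  - exact: fst_proj.
  exact: fst_rank1.
have exg j : exists k, snd_sys x j = Q k.
  apply: (span_idempotent QQ rQ oQ).
  - by apply: subvP (sx j); apply: addvS => //; exact: cycle_cartan_sub.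
  - exact: snd_proj.
  exact: snd_rank1.
have [[f fE] [g gE]] := (fin_all_exists exf, fin_all_exists exg).
have fI : injective f.
  move=> i j e; apply: (system_injective (@fst_proj _ x) (@fst_rank1 _ x) (@fst_orth _ x)).
  by rewrite !fE e.
have gI : injective g.
  move=> i j e; apply: (system_injective (@snd_proj _ x) (@snd_rank1 _ x) (@snd_orth _ x)).
  by rewrite !gE e.
exists (perm fI), (perm gI) => -[[[b i] r] c] /=; case: b.
  by rewrite gE col_projE !perm1 permE.
by rewrite fE mxE permE.
Qed.
End Fourier.
End StandardPair.

Theorem corollary18 (F : closedFieldType) (charF : [pchar F] =i pred0)
    (x : opair F) (hx : represents x (diag_cartan F) (cycle_cartan F)) :
  exists Z : set (moduli F),
    [/\ zariski_closed Z, irreducible Z, has_dimension Z 4,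
        Z (moduli_point x) &
        forall y, Z (moduli_point y) ->
          exists H1 H2, orthogonal_pair H1 H2 /\ represents y H1 H2].
Proof.
have F6 := pchar0_natf_neq0 charF.
(* Such a [z] is a primitive sixth root of unity. *)
have [z z2] : exists z : F, z ^+ 2 = z - 1.
  have [z zE] := @solve_monicpoly F 2 (fun i => if i == 0%N then -1 else 1) isT.
  by exists z; rewrite zE !big_ord_recl big_ord0 /= expr0 expr1 mulr1 mul1r addr0 addrC.
have [R [iota [eps [W [Y [epsK WY [eW eY] [W0 W1] ind]]]]]] := dephased_deformation charF z2.
have [s [t xE]] := standard_coordinates F6 z2 hx.
have Y0 j : Y j 0 = 1 by case: WY => d _ _; rewrite -[LHS]mul1r -(W1 j) d.
have Y1 i : Y 0 i = 1 by case: WY => d _ _; rewrite -[LHS]mul1r -(W0 i) d.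
exists (generic_family s t iota W Y); split.
- exact: generic_family_closed.
- exact: generic_family_irreducible.
- split=> [|f /(generic_family_indep s t iota F6 WY) dep].
    (* With row 0 and column 0 equal to 1, the cross ratio through them is the test entry itself; 36
       clears the two factors 1/6. *)
    pose f b := cross F (s^-1 (test_row b))%g (t^-1 (test_col b))%g (s^-1 0)%g (t^-1 0)%g *+ 36.
    exists f; apply/(generic_family_indep s t iota F6 WY) => p p0; apply: ind.
    rewrite -[RHS]p0; apply: eq_mmap => // b.
    rewrite /f (generic_valueMn _ _ _ F6 WY) (generic_value_cross s t iota F6 WY) Y0 Y1 W0 !mulr1.
    rewrite -mulrnAl -rmorphXn -rmorphMn -mulr_natr (_ : 36%:R = 6%:R ^+ 2); last by rewrite -natrX.
    by rewrite -exprMn mulVf // expr1n rmorph1 mul1r.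
  exact: (generic_dependent (q := fun i => projT1 (cid (inv_regular_rep (f i))))
    charF z2 epsK WY eW eY W0 W1 dep).
- apply: (generic_family_point (s := s) F6 epsK WY) => k.
  by rewrite xE /generic_entry map_sys_entry epsK eW eY.
by move=> y _; exact: opair_orthogonal.
Qed.
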